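(* Let $\kappa>0$ and $\lambda\ge 1$ be real numbers, put $\tau_\kappa=\frac{\kappa-\sqrt{\kappa^2+4}}{2}$, and let $f(z)=z+\sum_{n=2}^{\infty}a_nz^n$ belong to the class $\mathcal{SLB}_{\Sigma}^{\kappa}(\lambda;\tilde p_\kappa)$. Then $$|a_2|\le \frac{|\kappa\tau_\kappa|\sqrt{\kappa}}{\sqrt{\lambda(2\lambda-1)\kappa^2\tau_\kappa+(\kappa-(\kappa^2+2)\tau_\kappa)(2\lambda-1)^2}},$$ $$|a_3|\le \frac{|\kappa\tau_\kappa|\left[(\kappa-(\kappa^2+2)\tau_\kappa)(2\lambda-1)^2+(2\lambda^2-4\lambda+1)\kappa^2\tau_\kappa\right]}{(3\lambda-1)\left[\lambda(2\lambda-1)\kappa^2\tau_\kappa+(\kappa-(\kappa^2+2)\tau_\kappa)(2\lambda-1)^2\right]},$$ and for every $\mu\in\mathbb{R}$: if $0\le|\mu-1|\le \dfrac{\lambda(2\lambda-1)\kappa^2\tau_\kappa+(\kappa-(\kappa^2+2)\tau_\kappa)(2\lambda-1)^2}{\kappa^2|\tau_\kappa|(3\lambda-1)}$, then $$|a_3-\mu a_2^2|\le \frac{|\kappa\tau_\kappa|}{3\lambda-1};$$ if $|\mu-1|\ge \dfrac{\lambda(2\lambda-1)\kappa^2\tau_\kappa+(\kappa-(\kappa^2+2)\tau_\kappa)(2\lambda-1)^2}{\kappa^2|\tau_\kappa|(3\lambda-1)}$, then $$|a_3-\mu a_2^2|\le \frac{|1-\mu|\,\kappa^3\tau_\kapp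a^2}{\lambda(2\lambda-1)\kappa^2\tau_\kappa+(\kappa-(\kappa^2+2)\tau_\kappa)(2\lambda-1)^2}.$$
   Context: Let $\mathbb{D}=\{z\in\mathbb{C}:|z|<1\}$. $\mathcal{A}$ is the class of functions analytic in $\mathbb{D}$ of the form $f(z)=z+\sum_{n=2}^\infty a_nz^n$. $\Sigma$ is the class of bi-univalent functions: those $f\in\mathcal{A}$ that are univalent (injective) in $\mathbb{D}$ and whose inverse $g=f^{-1}$ (defined near $0$, with $g(w)=w-a_2w^2+(2a_2^2-a_3)w^3-\cdots$) extends to an analytic univalent function on $\mathbb{D}$, still denoted $g$. Subordination: for $F,G$ analytic in $\mathbb{D}$, $F\prec G$ means that there is an analytic function $\omega:\mathbb{D}\to\mathbb{C}$ with $\omega(0)=0$, $|\omega(z)|<1$ and $F(z)=G(\omega(z))$ for all $z\in\mathbb{D}$. For $\kappa>0$ and $\tau_\kappa=\frac{\kappa-\sqrt{\kappa^2+4}}{2}$, let $$\tilde p_\kappa(z)=\frac{1+\tau_\kappa^2z^2}{1-\kappa\tau_\kappa z-\tau_\kappa^2z^2},\qquad z\in\mathbb{D}.$$ For $\lambda\ge1$, a function $f\in\Sigma$ belongs to $\mathcal{SLB}_{\Sigma}^{\kappa}(\lambda;\tilde p_\kappa)$ if, with $g=f^{-1}$, $$\frac{z[f'(z)]^\lambda}{f(z)}\prec\tilde p_\kappa(z)\quad (z\in\mathbb{D})\qquad\text{and}\qquad \frac{w[g'(w)]^\lambda}{g(w)}\prec\tilde p_\kappa(w)\quad (w\in\mathbb{D}),$$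 where the powers are the analytic branches equal to $1$ at the origin and the quotients take the value $1$ at the origin. *)

(* Defs.v *)
From Stdlib Require Import Reals.
From Coquelicot Require Import Coquelicot.
Open Scope R_scope.

Definition in_disk (z : C) : Prop := Cmod z < 1.

(** Functions on the disk are total functions [C -> C]; every notion below
    constrains only their values on [in_disk]. *)

Definition analytic_at (f : C -> C) (z0 : C) : Prop :=
  exists (c : nat -> C) (r : R), 0 < r /\
    forall z : C, Cmod (z - z0)%C < r -> is_pseries c (z - z0)%C (f z).

Definition analytic_on_disk (f : C -> C) : Prop :=
  forall z0 : C, in_disk z0 -> analytic_at f z0.

Definition univalent_on_disk (f : C -> C) : Prop :=
  forall z1 z2 : C, in_disk z1 -> in_disk z2 -> f z1 = f z2 -> z1 = z2.

(** [f(z) = z + sum_(n >= 2) a_n z^n] on the disk. *)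
Definition normalized_expansion (f : C -> C) (a : nat -> C) : Prop :=
  a 0%nat = 0%C /\ a 1%nat = 1%C /\
  forall z : C, in_disk z -> is_pseries a z (f z).

Definition class_A (f : C -> C) : Prop :=
  analytic_on_disk f /\ exists a : nat -> C, normalized_expansion f a.

(** [g] is the analytic univalent extension to the disk of the germ at [0] of
    the inverse of [f]. By the identity theorem [g] is unique on the disk. *)
Definition univalent_inverse (f g : C -> C) : Prop :=
  analytic_on_disk g /\ univalent_on_disk g /\
  exists r : R, 0 < r /\
    forall w : C, Cmod w < r -> in_disk (g w) /\ f (g w) = w.

Definition class_Sigma (f : C -> C) : Prop :=
  class_A f /\ univalent_on_disk f /\ exists g : C -> C, univalent_inverse f g.

Definition subordinate (F G : C -> C) : Prop :=
  exists omega : C -> C,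
    analytic_on_disk omega /\ omega 0%C = 0%C /\
    (forall z : C, in_disk z -> Cmod (omega z) < 1) /\
    (forall z : C, in_disk z -> F z = G (omega z)).

Definition Cexp (z : C) : C :=
  (exp (Re z) * cos (Im z), exp (Re z) * sin (Im z)).

(** [h] is the analytic branch of [phi ^ lambda] equal to [1] at the origin:
    [h = exp (lambda * L)] for the analytic logarithm [L] of [phi] on the disk
    with [L 0 = 0]. *)
Definition power_branch (phi : C -> C) (lambda : R) (h : C -> C) : Prop :=
  exists L : C -> C,
    analytic_on_disk L /\ L 0%C = 0%C /\
    (forall z : C, in_disk z -> Cexp (L z) = phi z) /\
    (forall z : C, in_disk z -> h z = Cexp (RtoC lambda * L z)%C).

Definition quotient_fun (f h : C -> C) (z : C) : C :=
  if Ceq_dec z 0%C then 1%C else (z * h z / f z)%C.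

(** [z (f' z)^lambda / f z] is subordinate to [p]. For univalent [f] the branch
    [h] exists and is unique on the disk. *)
Definition power_quotient_subordinate (lambda : R) (f p : C -> C) : Prop :=
  exists h : C -> C,
    power_branch (C_derive f) lambda h /\ subordinate (quotient_fun f h) p.

Definition tau (kappa : R) : R := (kappa - sqrt (kappa ^ 2 + 4)) / 2.

Definition p_tilde (kappa : R) (z : C) : C :=
  ((1 + RtoC (tau kappa) ^ 2 * z ^ 2) /
   (1 - RtoC kappa * RtoC (tau kappa) * z - RtoC (tau kappa) ^ 2 * z ^ 2))%C.

Definition class_SLB (kappa lambda : R) (f : C -> C) : Prop :=
  class_Sigma f /\
  exists g : C -> C,
    univalent_inverse f g /\
    power_quotient_subordinate lambda f (p_tilde kappa) /\
    power_quotient_subordinate lambda g (p_tilde kappa).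

(* Main.v *)
Require Import Defs.
From Stdlib Require Import Reals Lra Classical ClassicalEpsilon.
From Coquelicot Require Import Coquelicot.
Open Scope R_scope.

(** Let [omega] and [upsilon] be the Schwarz functions of the two subordinations, with
    first coefficients [c1], [c2] and [d1], [d2]. Since
    [p_tilde z = 1 + kappa tau z + (kappa^2 + 2) tau^2 z^2 + ...] and the inverse of [f] has
    coefficients [- a2] and [2 a2^2 - a3], comparing coefficients up to order two
    ([subordination_coefficients], [inverse_coefficients]) gives four equations. The two of
    first order show [d1 = - c1] and express [c1] through [a2]. The sum of the two of second
    order becomes [a2^2 = A (c2 + d2) / 2], where [A = kappa^3 tau^2 / E] and
    [E = D - kappa (2 lambda - 1)^2 > 0]; their difference is
    [a3 - a2^2 = kappa tau (c2 - d2) / (2 (3 lambda - 1))].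

    What makes the denominator [D] rather than [E] is the sharp inequality
    [|c2| <= 1 - |c1|^2] ([schwarz_function_coef]), likewise for [d2]: since [|c1|^2] is a
    multiple of [|a2|^2], it yields an inequality for [|a2|^2] that can be solved. The bound
    on [a3] is then the triangle inequality, and the two cases for [a3 - mu a2^2] are in
    [fekete_szego_bound].

    The inequality [|c2| <= 1 - |c1|^2] is the Schwarz lemma applied to [omega / z] and then
    to a Moebius transform of it. It rests on a maximum principle for functions that have a
    second-order expansion with cubic error at every point of the disk: such expansions
    ([Jet]) are stable under the ring operations and inversion, and they
    forbid [|phi|^2 + e |z|^2] a local maximum. The same expansions at [0] serve to compare
    coefficients. *)

(** * Second-order expansions at the origin *)

(** The centre is excluded, so that a quotient by [h] has a jet without a value being
    assigned to it at [0]. *)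
Definition near0 (P : C -> Prop) : Prop :=
  exists r : R, 0 < r /\ forall h : C, 0 < Cmod h < r -> P h.

Lemma near0_and (P Q : C -> Prop) :
  near0 P -> near0 Q -> near0 (fun h => P h /\ Q h).
Proof.
  intros [r [Hr HP]] [s [Hs HQ]].
  exists (Rmin r s); split; [now apply Rmin_pos|].
  intros h Hh; pose proof (Rmin_l r s); pose proof (Rmin_r r s).
  split; [apply HP | apply HQ]; lra.
Qed.

Lemma near0_imp (P Q : C -> Prop) :
  (forall h : C, P h -> Q h) -> near0 P -> near0 Q.
Proof. intros H [r [Hr HP]]; exists r; split; auto. Qed.

Lemma near0_neq0 : near0 (fun h => h <> 0%C).
Proof.
  exists 1; split; [lra|]; intros h [Hh _]; now apply Cmod_gt_0.
Qed.

Lemma near0_small (e : R) : 0 < e -> near0 (fun h => Cmod h < e).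
Proof. intros He; exists e; split; auto; intros h Hh; lra. Qed.

Lemma near0_real (P : C -> Prop) (e : R) :
  near0 P -> 0 < e -> exists x : R, 0 < x < e /\ P (RtoC x).
Proof.
  intros [r [Hr HP]] He.
  assert (Hm : 0 < Rmin r e) by now apply Rmin_pos.
  pose proof (Rmin_l r e); pose proof (Rmin_r r e).
  exists (Rmin r e / 2); split; [lra|].
  apply HP; rewrite Cmod_R, Rabs_pos_eq; lra.
Qed.

Definition bounded0 (E : C -> C) : Prop :=
  exists K : R, near0 (fun h => Cmod (E h) <= K).

Lemma bounded0_const (c : C) : bounded0 (fun _ => c).
Proof. exists (Cmod c), 1; split; [lra|]; intros; lra. Qed.

Lemma bounded0_id : bounded0 (fun h => h).
Proof. exists 1, 1; split; [lra|]; intros; lra. Qed.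

Lemma bounded0_plus (E E' : C -> C) :
  bounded0 E -> bounded0 E' -> bounded0 (fun h => E h + E' h)%C.
Proof.
  intros [K HK] [K' HK']; exists (K + K').
  generalize (near0_and _ _ HK HK'); apply near0_imp.
  intros h [H H']; eapply Rle_trans; [apply Cmod_triangle|lra].
Qed.

Lemma bounded0_mult (E E' : C -> C) :
  bounded0 E -> bounded0 E' -> bounded0 (fun h => E h * E' h)%C.
Proof.
  intros [K HK] [K' HK']; exists (K * K').
  generalize (near0_and _ _ HK HK'); apply near0_imp.
  intros h [H H']; rewrite Cmod_mult.
  apply Rmult_le_compat; auto using Cmod_ge_0.
Qed.

Lemma bounded0_opp (E : C -> C) : bounded0 E -> bounded0 (fun h => - E h)%C.
Proof.
  intros [K HK]; exists K; revert HK; apply near0_imp.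
  intros h H; now rewrite Cmod_opp.
Qed.

Ltac bounded :=
  repeat first
    [ assumption | apply bounded0_id
    | apply bounded0_const
    | apply (bounded0_plus (fun _ => _) (fun _ => _))
    | apply (bounded0_mult (fun _ => _) (fun _ => _))
    | apply (bounded0_opp (fun _ => _)) ].

Lemma mult_bounded0_small (E : C -> C) (e : R) :
  bounded0 E -> 0 < e -> near0 (fun h => Cmod (h * E h) < e).
Proof.
  intros [K HK] He.
  assert (HK1 : 0 < Rabs K + 1) by (pose proof (Rabs_pos K); lra).
  assert (Hq : 0 < e / (Rabs K + 1)) by now apply Rdiv_lt_0_compat.
  generalize (near0_and _ _ HK (near0_small _ Hq)); apply near0_imp.
  intros h [H1 H2]; rewrite Cmod_mult.
  pose proof (Rle_abs K); pose proof (Cmod_ge_0 h).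
  apply Rle_lt_trans with (Cmod h * (Rabs K + 1)).
  - apply Rmult_le_compat_l; lra.
  - apply Rmult_lt_reg_r with (/ (Rabs K + 1)); [now apply Rinv_0_lt_compat|].
    rewrite Rmult_assoc, Rinv_r, Rmult_1_r; [exact H2|lra].
Qed.

(** A constant that is [O(h)] vanishes: evaluate at a point so small that the bound
    falls below the modulus of the constant. *)
Lemma const_eq_0 (c : C) (E : C -> C) :
  bounded0 E -> near0 (fun h => c = h * E h)%C -> c = 0%C.
Proof.
  intros HE Hc.
  destruct (Req_dec (Cmod c) 0) as [H0|H0]; [now apply Cmod_eq_0|].
  pose proof (Cmod_ge_0 c).
  assert (Hp : 0 < Cmod c) by lra.
  destruct (near0_real _ 1 (near0_and _ _ Hc (mult_bounded0_small _ _ HE Hp)) Rlt_0_1)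
    as [x [_ [H1 H2]]].
  rewrite <- H1 in H2; lra.
Qed.

(** [F = a0 + a1 h + a2 h^2 + O(h^3)]. The remainder is kept as a function [h^3 E] with
    [E] bounded, so that the calculus of expansions reduces to ring identities together
    with the closure of bounded functions under the ring operations. *)
Definition Jet (F : C -> C) (a0 a1 a2 : C) : Prop :=
  exists E : C -> C, bounded0 E /\
    near0 (fun h => F h = a0 + a1 * h + a2 * h ^ 2 + h ^ 3 * E h)%C.

Lemma Jet_ext (F G : C -> C) (a0 a1 a2 : C) :
  near0 (fun h => F h = G h) -> Jet F a0 a1 a2 -> Jet G a0 a1 a2.
Proof.
  intros H [E [HE HF]]; exists E; split; auto.
  generalize (near0_and _ _ H HF); apply near0_imp; intros h [<- ?]; auto.
Qed.

Lemma Jet_eq (F : C -> C) (a0 a1 a2 b0 b1 b2 : C) :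
  Jet F a0 a1 a2 -> a0 = b0 -> a1 = b1 -> a2 = b2 -> Jet F b0 b1 b2.
Proof. intros; subst; auto. Qed.

Lemma Jet_intro (F : C -> C) (a0 a1 a2 : C) (K : R) :
  near0 (fun h => Cmod (F h - (a0 + a1 * h + a2 * h ^ 2))%C <= K * Cmod h ^ 3) ->
  Jet F a0 a1 a2.
Proof.
  intros H.
  exists (fun h => (F h - (a0 + a1 * h + a2 * h ^ 2)) / h ^ 3)%C; split.
  - exists K; generalize (near0_and _ _ H near0_neq0); apply near0_imp.
    intros h [H1 H2].
    assert (H3 : (h ^ 3 <> 0)%C) by now apply Cpow_nz.
    rewrite Cmod_div, Cmod_pow by assumption.
    assert (0 < Cmod h ^ 3) by (apply pow_lt, Cmod_gt_0, H2).
    apply Rmult_le_reg_r with (Cmod h ^ 3); [assumption|].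
    unfold Rdiv; rewrite Rmult_assoc, Rinv_l, Rmult_1_r; lra.
  - generalize near0_neq0; apply near0_imp; intros h H2; field; assumption.
Qed.

Lemma Jet_const (c : C) : Jet (fun _ => c) c 0 0.
Proof.
  exists (fun _ => 0%C); split; [bounded|].
  exists 1; split; [lra|]; intros; ring.
Qed.

Lemma Jet_shift (c : C) : Jet (fun h => c + h)%C c 1 0.
Proof.
  exists (fun _ => 0%C); split; [bounded|].
  exists 1; split; [lra|]; intros; ring.
Qed.

Lemma Jet_cubic (E : C -> C) : bounded0 E -> Jet (fun h => h ^ 3 * E h)%C 0 0 0.
Proof.
  intros HE; exists E; split; auto.
  exists 1; split; [lra|]; intros; ring.
Qed.

Lemma Jet_plus (F G : C -> C) (a0 a1 a2 b0 b1 b2 : C) :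
  Jet F a0 a1 a2 -> Jet G b0 b1 b2 ->
  Jet (fun h => F h + G h)%C (a0 + b0) (a1 + b1) (a2 + b2).
Proof.
  intros [E [HE HF]] [E' [HE' HG]].
  exists (fun h => E h + E' h)%C; split; [bounded|].
  generalize (near0_and _ _ HF HG); apply near0_imp.
  intros h [-> ->]; ring.
Qed.

Lemma Jet_mult (F G : C -> C) (a0 a1 a2 b0 b1 b2 : C) :
  Jet F a0 a1 a2 -> Jet G b0 b1 b2 ->
  Jet (fun h => F h * G h)%C
    (a0 * b0) (a0 * b1 + a1 * b0) (a0 * b2 + a1 * b1 + a2 * b0).
Proof.
  intros [E [HE HF]] [E' [HE' HG]].
  exists (fun h => a1 * b2 + a2 * b1 + a2 * b2 * h
    + (a0 + a1 * h + a2 * (h * h)) * E' h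
    + E h * (b0 + b1 * h + b2 * (h * h) + (h * (h * h)) * E' h))%C.
  split; [bounded|].
  generalize (near0_and _ _ HF HG); apply near0_imp.
  intros h [-> ->]; ring.
Qed.

Lemma Jet_scal (c : C) (F : C -> C) (a0 a1 a2 : C) :
  Jet F a0 a1 a2 -> Jet (fun h => c * F h)%C (c * a0) (c * a1) (c * a2).
Proof.
  intros HF.
  eapply Jet_eq; [apply (Jet_mult _ _ _ _ _ _ _ _ (Jet_const c) HF)|..]; ring.
Qed.

Lemma Jet_factor (F : C -> C) (a0 a1 a2 : C) :
  Jet F a0 a1 a2 ->
  exists B : C -> C, bounded0 B /\ near0 (fun h => F h = a0 + h * B h)%C.
Proof.
  intros [E [HE HF]].
  exists (fun h => a1 + a2 * h + (h * h) * E h)%C; split; [bounded|].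
  revert HF; apply near0_imp; intros h ->; ring.
Qed.

Lemma Jet_near (F : C -> C) (a0 a1 a2 : C) (e : R) :
  Jet F a0 a1 a2 -> 0 < e -> near0 (fun h => Cmod (F h - a0)%C < e).
Proof.
  intros HF He; destruct (Jet_factor _ _ _ _ HF) as [B [HB HFB]].
  generalize (near0_and _ _ HFB (mult_bounded0_small B e HB He)); apply near0_imp.
  intros h [-> H]; now replace (a0 + h * B h - a0)%C with (h * B h)%C by ring.
Qed.

Lemma Jet_neq0 (F : C -> C) (a0 a1 a2 : C) :
  Jet F a0 a1 a2 -> a0 <> 0%C -> near0 (fun h => Cmod a0 / 2 <= Cmod (F h)).
Proof.
  intros HF H0; apply Cmod_gt_0 in H0.
  assert (Hh : 0 < Cmod a0 / 2) by lra.
  generalize (Jet_near _ _ _ _ _ HF Hh); apply near0_imp.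
  intros h H.
  pose proof (Cmod_triangle (F h) (- (F h - a0))) as T.
  replace (F h + - (F h - a0))%C with a0 in T by ring.
  rewrite Cmod_opp in T; lra.
Qed.

Lemma Cminus_eq_0 (x y : C) : (x - y = 0)%C -> x = y.
Proof. intros H; replace x with (y + (x - y))%C by ring; rewrite H; ring. Qed.

Lemma Cmult_eq_reg_l (r x y : C) : (r * x = r * y)%C -> r <> 0%C -> x = y.
Proof.
  intros H Hr; replace x with (/ r * (r * x))%C by (field; auto).
  rewrite H; field; auto.
Qed.

Lemma Jet_unique (F : C -> C) (a0 a1 a2 b0 b1 b2 : C) :
  Jet F a0 a1 a2 -> Jet F b0 b1 b2 -> a0 = b0 /\ a1 = b1 /\ a2 = b2.
Proof.
  intros [E [HE HF]] [E' [HE' HG]].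
  pose proof (near0_and _ _ (near0_and _ _ HF HG) near0_neq0) as H.
  assert (e0 : (a0 - b0 = 0)%C).
  { apply const_eq_0 with (fun h => b1 + - a1 + (b2 + - a2) * h
      + h * h * (E' h + - E h))%C; [bounded|].
    revert H; apply near0_imp; intros h [[H1 H2] _]; rewrite H1 in H2.
    transitivity (a0 + a1 * h + a2 * h ^ 2 + h ^ 3 * E h - (b0 + a1 * h + a2 * h ^ 2 + h ^ 3 * E h))%C;
    [ring|rewrite H2; ring]. }
  apply Cminus_eq_0 in e0; subst b0.
  assert (e1 : (a1 - b1 = 0)%C).
  { apply const_eq_0 with (fun h => (b2 + - a2) + h * (E' h + - E h))%C; [bounded|].
    revert H; apply near0_imp; intros h [[H1 H2] Hh]; rewrite H1 in H2.
    apply (Cmult_eq_reg_l h); [|auto].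
    transitivity (a0 + a1 * h + a2 * h ^ 2 + h ^ 3 * E h - (a0 + b1 * h + a2 * h ^ 2 + h ^ 3 * E h))%C;
    [ring|rewrite H2; ring]. }
  apply Cminus_eq_0 in e1; subst b1.
  assert (e2 : (a2 - b2 = 0)%C).
  { apply const_eq_0 with (fun h => (E' h + - E h))%C; [bounded|].
    revert H; apply near0_imp; intros h [[H1 H2] Hh]; rewrite H1 in H2.
    apply (Cmult_eq_reg_l (h ^ 2)%C); [|now apply Cpow_nz].
    transitivity (a0 + a1 * h + a2 * h ^ 2 + h ^ 3 * E h - (a0 + a1 * h + b2 * h ^ 2 + h ^ 3 * E h))%C;
    [ring|rewrite H2; ring]. }
  apply Cminus_eq_0 in e2; subst b2; auto.
Qed.

(** The stated coefficients are those of a quadratic [Q] with [G Q = 1 + O(h^3)]. Near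
    [0] the function [1 / G] is bounded, so [1 / G - Q = (1 - G Q) / G] is [O(h^3)]. *)
Lemma Jet_inv (G : C -> C) (b0 b1 b2 : C) :
  Jet G b0 b1 b2 -> b0 <> 0%C ->
  Jet (fun h => / G h)%C (/ b0) (- b1 / b0 ^ 2) (b1 ^ 2 / b0 ^ 3 - b2 / b0 ^ 2).
Proof.
  intros HG H0.
  set (c1 := (- b1 / b0 ^ 2)%C); set (c2 := (b1 ^ 2 / b0 ^ 3 - b2 / b0 ^ 2)%C).
  assert (HB : bounded0 (fun h => / G h)%C).
  { exists (/ (Cmod b0 / 2)); generalize (Jet_neq0 _ _ _ _ HG H0).
    apply near0_imp; intros h Hh; apply Cmod_gt_0 in H0.
    rewrite Cmod_inv; [apply Rinv_le_contravar; lra|].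
    apply Cmod_gt_0; lra. }
  assert (HQ : Jet (fun h => / b0 + c1 * h + c2 * h ^ 2)%C (/ b0) c1 c2).
  { exists (fun _ => 0%C); split; [bounded|].
    exists 1; split; [lra|]; intros; ring. }
  pose proof (Jet_mult _ _ _ _ _ _ _ _ HG HQ) as [E [HE HP]].
  exists (fun h => - (/ G h * E h))%C; split; [bounded|].
  generalize (near0_and _ _ HP (Jet_neq0 _ _ _ _ HG H0)); apply near0_imp.
  intros h [H1 H2].
  assert (HG0 : G h <> 0%C) by (apply Cmod_gt_0 in H0; apply Cmod_gt_0; lra).
  replace (b0 * / b0)%C with (RtoC 1) in H1 by (field; auto).
  replace (b0 * c1 + b1 * / b0)%C with (RtoC 0) in H1 by (unfold c1; field; auto).
  replace (b0 * c2 + b1 * c1 + b2 * / b0)%C with (RtoC 0) in H1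
    by (unfold c1, c2; field; auto).
  replace (h ^ 3 * - (/ G h * E h))%C with (- / G h * (h ^ 3 * E h))%C by ring.
  replace (h ^ 3 * E h)%C with (G h * (/ b0 + c1 * h + c2 * h ^ 2) - 1)%C
    by (rewrite H1; ring).
  field; split; auto.
Qed.

(** The remainder of [F] is controlled only away from [0], while [G] may vanish at points
    arbitrarily close to [0]. The exact value [F 0 = a0] covers those points. *)
Lemma Jet_comp (F G : C -> C) (a0 a1 a2 b1 b2 : C) :
  Jet F a0 a1 a2 -> F 0%C = a0 -> Jet G 0 b1 b2 ->
  Jet (fun h => F (G h)) a0 (a1 * b1) (a1 * b2 + a2 * b1 ^ 2).
Proof.
  intros [E [[K [r [Hr HK]]] [s [Hs HF]]]] F0 HG.
  destruct (Jet_factor _ _ _ _ HG) as [B [HB HGB]].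
  set (E' := fun w => if Ceq_dec w 0%C then RtoC 0 else E w).
  assert (HE' : bounded0 (fun h => E' (G h))).
  { exists (Rmax 0 K); generalize (Jet_near _ _ _ _ _ HG Hr); apply near0_imp.
    intros h Hh; unfold E'; destruct (Ceq_dec (G h) 0%C) as [e|n].
    - rewrite Cmod_0; apply Rmax_l.
    - eapply Rle_trans; [apply HK|apply Rmax_r].
      replace (G h - 0)%C with (G h) in Hh by ring.
      split; [now apply Cmod_gt_0|exact Hh]. }
  assert (HJ : Jet (fun h => (a0 + a1 * G h) + a2 * (G h * G h)
                  + h ^ 3 * (B h * (B h * B h) * E' (G h)))%C
                 a0 (a1 * b1) (a1 * b2 + a2 * b1 ^ 2)).
  { eapply Jet_eq.
    - apply Jet_plus; [apply Jet_plus; [apply Jet_plus;[apply Jet_const|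
        apply Jet_scal, HG] | apply Jet_scal, Jet_mult; apply HG]|].
      apply Jet_cubic; bounded.
    - ring.
    - ring.
    - ring. }
  revert HJ; apply Jet_ext.
  generalize (near0_and _ _ HGB (Jet_near _ _ _ _ _ HG Hs)); apply near0_imp.
  intros h [H1 H2]; replace (G h - 0)%C with (G h) in H2 by ring.
  replace (h ^ 3 * (B h * (B h * B h) * E' (G h)))%C
    with ((0 + h * B h) ^ 3 * E' (G h))%C by ring.
  rewrite <- H1; unfold E'; destruct (Ceq_dec (G h) 0%C) as [e|n].
  - rewrite e, F0; ring.
  - rewrite HF; [ring|]; split; [now apply Cmod_gt_0|exact H2].
Qed.

(** * Power series and their derivatives *)

Lemma Cpow_n (z : C) (n : nat) : @pow_n C_AbsRing z n = (z ^ n)%C.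
Proof. induction n as [|n IH]; simpl; [reflexivity|now rewrite IH]. Qed.

Lemma is_pseries_C (c : nat -> C) (z l : C) :
  is_pseries c z l <-> is_series (fun n => z ^ n * c n)%C l.
Proof.
  assert (E : forall n, (@pow_n C_AbsRing z n * c n = z ^ n * c n)%C)
    by (intros n; exact (f_equal (fun w => w * c n)%C (Cpow_n z n))).
  unfold is_pseries; split; apply is_series_ext; intros n; [|symmetry]; apply E.
Qed.

Lemma is_series_Cmod_le (b : nat -> C) (B : nat -> R) (l : C) (S : R) :
  is_series b l -> (forall n, Cmod (b n) <= B n) ->
  (forall n, sum_n B n <= S) -> Cmod l <= S.
Proof.
  intros Hb HB HS.
  assert (Hpart : forall n, Cmod (sum_n b n) <= sum_n B n).
  { intros n; induction n as [|n IH]; [rewrite !sum_O; apply HB|].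
    rewrite !sum_Sn; eapply Rle_trans; [apply Cmod_triangle|].
    apply Rplus_le_compat; auto. }
  destruct (Rle_or_lt (Cmod l) S) as [H|H]; [exact H|exfalso].
  assert (He : 0 < Cmod l - S) by lra.
  pose proof (proj1 (filterlim_locally_ball_norm _ _) Hb (mkposreal _ He)) as [N HN].
  specialize (HN N (Nat.le_refl N)).
  unfold ball_norm in HN; change (Cmod (sum_n b N - l)%C < Cmod l - S) in HN.
  pose proof (Cmod_triangle (sum_n b N) (- (sum_n b N - l))) as T.
  replace (sum_n b N + - (sum_n b N - l))%C with l in T by ring.
  rewrite Cmod_opp in T; pose proof (Hpart N); pose proof (HS N); lra.
Qed.

(** The terms are differences of consecutive partial sums, and these are bounded. *)
Lemma is_series_bounded (b : nat -> C) (l : C) :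
  is_series b l -> exists K : R, forall n, Cmod (b n) <= K.
Proof.
  intros Hb.
  destruct (filterlim_bounded (sum_n b)) as [M HM]; [now exists l|].
  assert (HM' : forall n, Cmod (sum_n b n) <= M) by exact HM.
  exists (M + M); intros [|n].
  - rewrite <- (sum_O b); pose proof (HM' 0%nat).
    pose proof (Cmod_ge_0 (sum_n b 0)); lra.
  - replace (b (S n)) with (sum_n b (S n) + - sum_n b n)%C
      by (rewrite sum_Sn; change plus with Cplus; ring).
    eapply Rle_trans; [apply Cmod_triangle|]; rewrite Cmod_opp.
    apply Rplus_le_compat; apply HM'.
Qed.

Lemma sum_half_pow_le (K : R) (n : nat) :
  0 <= K -> sum_n (fun k => K * (/ 2) ^ k) n <= 2 * K.
Proof.
  intros HK.
  assert (E : sum_n (fun k => K * (/ 2) ^ k) n = 2 * K - K * (/ 2) ^ n).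
  { induction n as [|n IH]; [rewrite sum_O; simpl; ring|].
    rewrite sum_Sn, IH; change plus with Rplus; simpl; field. }
  rewrite E; assert (0 < (/ 2) ^ n) by (apply pow_lt; lra); nra.
Qed.

(** The radius is left implicit, since only the germ at [0] matters; shifting the
    coefficients then corresponds to dividing by [h]. *)
Definition series_near0 (c : nat -> C) (F : C -> C) : Prop :=
  near0 (fun h => is_pseries c h (F h)).

Lemma series_near0_coef_bound (c : nat -> C) (F : C -> C) :
  series_near0 c F ->
  exists s K : R, 0 < s /\ 0 <= K /\
    (forall n, Cmod (c n) * s ^ n <= K) /\
    (forall h, 0 < Cmod h < s -> is_pseries c h (F h)).
Proof.
  intros [r [Hr H]].
  assert (Hs : Cmod (RtoC (r / 2)) = r / 2) by (rewrite Cmod_R, Rabs_pos_eq; lra).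
  assert (H2 : 0 < Cmod (RtoC (r / 2)) < r) by lra.
  destruct (is_series_bounded _ _ (proj1 (is_pseries_C _ _ _) (H _ H2))) as [K HK].
  exists (r / 2), K; split; [lra|]; split; [|split].
  - eapply Rle_trans; [apply Cmod_ge_0|apply (HK 0%nat)].
  - intros n; specialize (HK n).
    rewrite Cmod_mult, Cmod_pow, Hs in HK; lra.
  - intros h Hh; apply H; lra.
Qed.

(** On half of a radius where the terms stay bounded, the terms are dominated by a
    geometric series of ratio [1/2]. *)
Lemma series_near0_bounded (c : nat -> C) (F : C -> C) :
  series_near0 c F -> bounded0 F.
Proof.
  intros HF; destruct (series_near0_coef_bound _ _ HF) as [s [K [Hs [HK [Hc HS]]]]].
  exists (2 * K), (s / 2); split; [lra|]; intros h Hh.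
  apply is_series_Cmod_le with (fun n => h ^ n * c n)%C (fun n => K * (/ 2) ^ n).
  - apply is_pseries_C, HS; lra.
  - intros n; rewrite Cmod_mult, Cmod_pow.
    apply Rle_trans with ((s / 2) ^ n * Cmod (c n)).
    + apply Rmult_le_compat_r; [apply Cmod_ge_0|apply pow_incr; lra].
    + unfold Rdiv; rewrite Rpow_mult_distr.
      assert (0 < (/ 2) ^ n) by (apply pow_lt; lra).
      specialize (Hc n); nra.
  - intros n; now apply sum_half_pow_le.
Qed.

Lemma series_near0_shift (c : nat -> C) (F : C -> C) :
  series_near0 c F ->
  series_near0 (fun n => c (S n)) (fun h => (F h - c 0%nat) / h)%C.
Proof.
  intros H; generalize (near0_and _ _ H near0_neq0); apply near0_imp.
  intros h [H1 H2].
  assert (Hi : @mult C_AbsRing (/ h)%C h = one)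
    by (change (/ h * h = 1)%C; field; auto).
  pose proof (is_pseries_decr_1 (V := C_NormedModule) c h (/ h)%C (F h) Hi H1) as H3.
  replace ((F h - c 0%nat) / h)%C with (/ h * (F h + - c 0%nat))%C
    by (field; auto).
  exact H3.
Qed.

(** The remainder divided by [h^3] is the sum of the series shifted three times, hence
    bounded. *)
Lemma series_near0_Jet (c : nat -> C) (F : C -> C) :
  series_near0 c F -> Jet F (c 0%nat) (c 1%nat) (c 2%nat).
Proof.
  intros H.
  pose proof (series_near0_bounded _ _
    (series_near0_shift _ _ (series_near0_shift _ _ (series_near0_shift _ _ H)))) as HB.
  eexists; split; [exact HB|].
  generalize near0_neq0; apply near0_imp; intros h Hh; cbv beta; field; auto.
Qed.

Lemma analytic_at_series (F : C -> C) (z0 : C) :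
  analytic_at F z0 ->
  exists c, c 0%nat = F z0 /\ series_near0 c (fun h => F (z0 + h)%C).
Proof.
  intros [c [r [Hr H]]]; exists c; split.
  - assert (H0 : @is_pseries C_AbsRing C_NormedModule c (RtoC 0) (F z0)).
    { replace (RtoC 0) with (z0 - z0)%C by ring; apply H.
      replace (z0 - z0)%C with (RtoC 0) by ring; rewrite Cmod_0; exact Hr. }
    pose proof (is_pseries_0 (K := C_AbsRing) (V := C_NormedModule) c) as H1.
    exact (filterlim_locally_unique _ _ _ H1 H0).
  - exists r; split; [exact Hr|]; intros h Hh.
    replace h with (z0 + h - z0)%C at 1 by ring; apply H.
    replace (z0 + h - z0)%C with h by ring; lra.
Qed.

(** The factor [s] on the left replaces [s ^ (n - 1)] on the right. *)
Lemma Cpow_minus_le (u v : C) (s : R) (n : nat) :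
  Cmod u <= s -> Cmod v <= s ->
  Cmod (u ^ n - v ^ n)%C * s <= INR n * s ^ n * Cmod (u - v)%C.
Proof.
  intros Hu Hv; assert (Hs : 0 <= s) by (pose proof (Cmod_ge_0 u); lra).
  induction n as [|n IH].
  - simpl; replace (1 - 1)%C with (RtoC 0) by ring; rewrite Cmod_0; lra.
  - replace (u ^ S n - v ^ S n)%C with (u * (u ^ n - v ^ n) + v ^ n * (u - v))%C
      by (simpl; ring).
    apply Rle_trans with ((s * Cmod (u ^ n - v ^ n)%C + s ^ n * Cmod (u - v)%C) * s).
    + apply Rmult_le_compat_r; [exact Hs|].
      eapply Rle_trans; [apply Cmod_triangle|]; rewrite !Cmod_mult, Cmod_pow.
      apply Rplus_le_compat; apply Rmult_le_compat_r; auto using Cmod_ge_0.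
      apply pow_incr; split; auto using Cmod_ge_0.
    + rewrite S_INR; simpl pow; nra.
Qed.

(** On a quarter of a radius where [c n * s ^ n] is bounded, the factor [n] that comes
    from [u^n - v^n] is absorbed by [n / 4^n <= 1 / 2^n]. *)
Lemma series_near0_Lipschitz (c : nat -> C) (F : C -> C) :
  series_near0 c F ->
  exists s K : R, 0 < s /\ forall u v : C, 0 < Cmod u < s -> 0 < Cmod v < s ->
    Cmod (F u - F v)%C <= K * Cmod (u - v)%C.
Proof.
  intros HF; destruct (series_near0_coef_bound _ _ HF) as [s [K [Hs [HK [Hc HS]]]]].
  exists (s / 4), (2 * (K * (4 / s))); split; [lra|]; intros u v Hu Hv.
  rewrite Rmult_assoc.
  apply is_series_Cmod_le with (fun n => (u ^ n - v ^ n) * c n)%C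
    (fun n => (K * (4 / s) * Cmod (u - v)%C) * (/ 2) ^ n).
  - assert (Su : is_pseries c u (F u)) by (apply HS; lra).
    assert (Sv : is_pseries c v (F v)) by (apply HS; lra).
    apply is_pseries_C in Su; apply is_pseries_C in Sv.
    generalize (is_series_minus (V := C_NormedModule) _ _ _ _ Su Sv).
    apply is_series_ext; intros n.
    change (u ^ n * c n + - (v ^ n * c n) = (u ^ n - v ^ n) * c n)%C; ring.
  - intros n; rewrite Cmod_mult.
    assert (H := Cpow_minus_le u v (s / 4) n ltac:(lra) ltac:(lra)).
    assert (Hn : INR n * (/ 4) ^ n <= (/ 2) ^ n).
    { clear; induction n as [|n IH]; [simpl; lra|].
      rewrite S_INR; simpl.
      assert (0 < (/ 4) ^ n <= (/ 2) ^ n)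
        by (split; [apply pow_lt; lra|apply pow_incr; lra]); nra. }
    assert (E : (s / 4) ^ n = s ^ n * (/ 4) ^ n)
      by (unfold Rdiv; apply Rpow_mult_distr).
    rewrite E in H.
    pose proof (Cmod_ge_0 (u - v)%C) as Hd; pose proof (Cmod_ge_0 (c n)) as Hcn.
    assert (0 <= INR n * (/ 4) ^ n)
      by (apply Rmult_le_pos; [apply pos_INR|apply pow_le; lra]).
    assert (H1 : Cmod (u ^ n - v ^ n)%C * (s / 4) * Cmod (c n)
                 <= (INR n * (/ 4) ^ n) * Cmod (u - v)%C * K).
    { apply Rle_trans with (INR n * (s ^ n * (/ 4) ^ n) * Cmod (u - v)%C * Cmod (c n)).
      - now apply Rmult_le_compat_r.
      - replace (INR n * (s ^ n * (/ 4) ^ n) * Cmod (u - v)%C * Cmod (c n))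
          with ((INR n * (/ 4) ^ n) * Cmod (u - v)%C * (Cmod (c n) * s ^ n)) by ring.
        apply Rmult_le_compat_l; [now apply Rmult_le_pos|apply Hc]. }
    apply Rmult_le_reg_r with (s / 4); [lra|].
    replace (K * (4 / s) * Cmod (u - v)%C * (/ 2) ^ n * (s / 4))
      with ((/ 2) ^ n * (Cmod (u - v)%C * K)) by (field; lra).
    assert (0 <= Cmod (u - v)%C * K) by now apply Rmult_le_pos.
    nra.
  - intros n; apply sum_half_pow_le.
    assert (0 < 4 / s) by (apply Rdiv_lt_0_compat; lra).
    apply Rmult_le_pos; [apply Rmult_le_pos; lra|apply Cmod_ge_0].
Qed.

Lemma C_derive_Jet (F : C -> C) (z a1 a2 : C) :
  Jet (fun h => F (z + h)%C) (F z) a1 a2 -> C_derive F z = a1.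
Proof.
  intros HJ.
  assert (HQ : exists K, near0 (fun h =>
             Cmod (F (z + h) - F z - h * a1)%C <= K * Cmod h ^ 2)).
  { destruct HJ as [E [HE HF]].
    assert (HB : bounded0 (fun h => a2 + h * E h)%C) by bounded.
    destruct HB as [K HK]; exists K.
    generalize (near0_and _ _ HK HF); apply near0_imp; intros h [H1 ->].
    replace (F z + a1 * h + a2 * h ^ 2 + h ^ 3 * E h - F z - h * a1)%C
      with ((a2 + h * E h) * h ^ 2)%C by ring.
    rewrite Cmod_mult, Cmod_pow; apply Rmult_le_compat_r; [|exact H1].
    apply pow_le, Cmod_ge_0. }
  destruct HQ as [K [r [Hr HQ]]].
  apply is_C_derive_unique.
  split; [apply (is_linear_scal_l (K := C_AbsRing) (V := C_NormedModule))|].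
  intros x Hx.
  assert (Ex : z = x)
    by now apply (is_filter_lim_locally_unique (K := C_AbsRing)
                    (V := AbsRing_NormedModule C_AbsRing)).
  subst x.
  intros [eps Heps].
  assert (HK1 : 0 < Rabs K + 1) by (pose proof (Rabs_pos K); lra).
  assert (Hd : 0 < Rmin r (eps / (Rabs K + 1)))
    by (apply Rmin_pos; [exact Hr|now apply Rdiv_lt_0_compat]).
  enough (G : forall y : C, Cmod (y - z)%C < Rmin r (eps / (Rabs K + 1)) ->
            Cmod (F y - F z - (y - z) * a1)%C <= eps * Cmod (y - z)%C)
    by (exists (mkposreal _ Hd); exact G).
  intros y Hy.
  pose proof (Rmin_l r (eps / (Rabs K + 1))).
  pose proof (Rmin_r r (eps / (Rabs K + 1))).
  pose proof (Cmod_ge_0 (y - z)%C) as Hp.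
  destruct (Req_dec (Cmod (y - z)%C) 0) as [Hyz|Hyz].
  - rewrite Hyz, Rmult_0_r; apply Cmod_eq_0 in Hyz.
    replace y with (z + (y - z))%C by ring; rewrite Hyz.
    replace (z + 0)%C with z by ring.
    replace (F z - F z - (z - z) * a1)%C with (RtoC 0) by ring.
    rewrite Cmod_0; lra.
  - specialize (HQ (y - z)%C ltac:(lra)).
    replace (z + (y - z))%C with y in HQ by ring.
    eapply Rle_trans; [exact HQ|].
    replace (K * Cmod (y - z)%C ^ 2) with (K * Cmod (y - z)%C * Cmod (y - z)%C) by ring.
    apply Rmult_le_compat_r; [exact Hp|].
    apply Rle_trans with ((Rabs K + 1) * Cmod (y - z)%C).
    + pose proof (Rle_abs K); nra.
    + replace eps with ((Rabs K + 1) * (eps / (Rabs K + 1))) by (field; lra).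
      apply Rmult_le_compat_l; lra.
Qed.

(** Second-order expansion of the derivative without differentiating the series. Write
    [F] as a cubic plus [z^4 E]. The difference quotient of [z^4 E] on steps shorter than
    [|z|] is [O(|z|^3)], because [E] is bounded and Lipschitz near [0]. Since [F] is
    differentiable at [z] by its expansion there, the derivative of the tail obeys the
    same bound. *)
Lemma C_derive_series_Jet (c : nat -> C) (F : C -> C) :
  near0 (fun z => analytic_at F z) -> series_near0 c F ->
  Jet (C_derive F) (c 1%nat) (2 * c 2%nat)%C (3 * c 3%nat)%C.
Proof.
  intros Han HF.
  pose proof (series_near0_shift _ _ (series_near0_shift _ _
    (series_near0_shift _ _ (series_near0_shift _ _ HF)))) as HS.
  match type of HS with series_near0 _ ?G => set (E := G) in HS end.
  destruct (series_near0_Lipschitz _ _ HS) as [s [L [Hs HL]]].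
  destruct (series_near0_bounded _ _ HS) as [K [s' [Hs' HK]]].
  assert (HFE : forall h : C, h <> 0%C ->
    F h = (c 0%nat + c 1%nat * h + c 2%nat * h ^ 2 + c 3%nat * h ^ 3 + h ^ 4 * E h)%C)
    by (intros h Hh; unfold E; field; auto).
  clearbody E.
  apply (Jet_intro _ _ _ _ (15 * Rabs K + Rabs L)).
  assert (Hm : 0 < Rmin 1 (Rmin s s' / 2))
    by (apply Rmin_pos; [lra|]; assert (0 < Rmin s s') by (now apply Rmin_pos); lra).
  generalize (near0_and _ _ Han (near0_and _ _ near0_neq0 (near0_small _ Hm))).
  apply near0_imp; intros z [Hz [Hz0 Hzs]].
  pose proof (Rmin_l 1 (Rmin s s' / 2)); pose proof (Rmin_r 1 (Rmin s s' / 2)).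
  pose proof (Rmin_l s s'); pose proof (Rmin_r s s').
  destruct (analytic_at_series _ _ Hz) as [d [Hd0 Hd]].
  pose proof (series_near0_Jet _ _ Hd) as HJ; rewrite Hd0 in HJ.
  rewrite (C_derive_Jet _ _ _ _ HJ).
  apply le_epsilon; intros eps Heps.
  destruct HJ as [e [HE HJ]].
  assert (HB : bounded0 (fun h => d 2%nat + h * e h
      - (c 2%nat + c 3%nat * (3 * z + h)))%C) by (unfold Cminus; bounded).
  assert (Hz' : 0 < Cmod z) by now apply Cmod_gt_0.
  assert (HN : near0 (fun h => Cmod h < Cmod z)) by now apply near0_small.
  destruct (near0_real _ 1 (near0_and _ _ near0_neq0 (near0_and _ _ HN
     (near0_and _ _ HJ (mult_bounded0_small _ _ HB Heps)))) Rlt_0_1)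
    as [x [_ [Hx0 [Hxz [Hx1 Hx2]]]]].
  set (h := RtoC x) in *; clearbody h.
  assert (Hzh : (z + h)%C <> 0%C).
  { intros Hs0; replace h with (- z)%C in Hxz
      by (replace h with (z + h - z)%C by ring; rewrite Hs0; ring).
    rewrite Cmod_opp in Hxz; lra. }
  assert (Hzh2 : 0 < Cmod (z + h)%C < Rmin s s').
  { split; [now apply Cmod_gt_0|].
    eapply Rle_lt_trans; [apply Cmod_triangle|lra]. }
  rewrite (HFE _ Hz0), (HFE _ Hzh) in Hx1.
  (* The first two terms are the difference quotient of [z^4 E] with step [h]; the third
     is the error made in replacing the derivative of [F] by its difference quotient. *)
  replace (d 1%nat - (c 1%nat + 2 * c 2%nat * z + 3 * c 3%nat * z ^ 2))%C
    with ((4 * z ^ 3 + 6 * z ^ 2 * h + 4 * z * h ^ 2 + h ^ 3) * E (z + h)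
          + z ^ 4 * ((E (z + h) - E z) / h)
          + - (h * (d 2%nat + h * e h - (c 2%nat + c 3%nat * (3 * z + h)))))%C.
  2: { apply (Cmult_eq_reg_l h); [|exact Hx0].
       apply Cminus_eq_0.
       match type of Hx1 with ?A = ?B => transitivity (A - B)%C end;
         [field; auto | rewrite Hx1; ring]. }
  eapply Rle_trans; [apply Cmod_triangle|]; rewrite Cmod_opp.
  apply Rplus_le_compat; [|lra].
  eapply Rle_trans; [apply Cmod_triangle|].
  rewrite Rmult_plus_distr_r; rewrite !Cmod_mult.
  apply Rplus_le_compat.
  - rewrite (Rmult_assoc 15), (Rmult_comm (Rabs K)), <- Rmult_assoc.
    apply Rmult_le_compat; auto using Cmod_ge_0.
    + assert (Hp : 0 <= Cmod h) by apply Cmod_ge_0.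
      eapply Rle_trans; [apply Cmod_triangle|].
      eapply Rle_trans; [apply Rplus_le_compat_r, Cmod_triangle|].
      eapply Rle_trans; [apply Rplus_le_compat_r, Rplus_le_compat_r, Cmod_triangle|].
      rewrite !Cmod_mult, !Cmod_pow, !Cmod_R, !Rabs_pos_eq by lra.
      set (p := Cmod z) in *; set (q := Cmod h) in *.
      assert (q ^ 2 <= p ^ 2) by (apply pow_incr; lra).
      assert (q ^ 3 <= p ^ 3) by (apply pow_incr; lra).
      assert (0 <= p ^ 2) by (apply pow_le; lra).
      nra.
    + eapply Rle_trans; [apply HK; lra|apply Rle_abs].
  - rewrite Cmod_div by exact Hx0.
    assert (HLz : Cmod (E (z + h)%C - E z)%C / Cmod h <= Rabs L).
    { assert (0 < Cmod h) by now apply Cmod_gt_0.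
      apply Rmult_le_reg_r with (Cmod h); [assumption|].
      unfold Rdiv; rewrite Rmult_assoc, Rinv_l, Rmult_1_r by lra.
      eapply Rle_trans; [apply HL; lra|].
      replace (z + h - z)%C with h by ring.
      apply Rmult_le_compat_r; [lra|apply Rle_abs]. }
    assert (Hpz : Cmod (z ^ 4)%C <= Cmod z ^ 3).
    { rewrite Cmod_pow; simpl.
      assert (0 < Cmod z * (Cmod z * (Cmod z * 1))) by (assert (0 < Cmod z * Cmod z) by nra; nra).
      nra. }
    rewrite (Rmult_comm (Rabs L)).
    apply Rmult_le_compat; auto using Cmod_ge_0.
    assert (0 < Cmod h) by now apply Cmod_gt_0.
    apply Rmult_le_pos; [apply Cmod_ge_0|]; apply Rlt_le, Rinv_0_lt_compat; assumption.
Qed.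

(** * Maximum principle and the coefficients of Schwarz functions *)

Lemma Cmod_lt_coords (z p : C) (d : R) :
  Rabs (fst z - fst p) < d -> Rabs (snd z - snd p) < d -> Cmod (z - p)%C < 2 * d.
Proof.
  intros H1 H2.
  replace (z - p)%C with (RtoC (fst z - fst p) + Ci * RtoC (snd z - snd p))%C.
  - eapply Rle_lt_trans; [apply Cmod_triangle|].
    rewrite Cmod_mult, Cmod_Ci, !Cmod_R; lra.
  - destruct z, p; unfold Cminus, Cplus, Cmult, Copp, Ci, RtoC; simpl; f_equal; ring.
Qed.

Lemma Cmod_le_Cmod_minus (p z : C) : Cmod p <= Cmod z + Cmod (z - p)%C.
Proof.
  pose proof (Cmod_triangle z (- (z - p))) as T.
  replace (z + - (z - p))%C with p in T by ring.
  now rewrite Cmod_opp in T.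
Qed.

(** Compactness without covers: a property of points and sizes that holds locally holds
    with one size on the whole disk. The underlying compactness of the square also asks
    for sizes at centres outside the disk. *)
Lemma disk_compact (rho : R) (Q : C -> R -> Prop) :
  (forall z e e', e' <= e -> Q z e -> Q z e') ->
  (forall p, Cmod p <= rho -> exists d, 0 < d /\
     forall z, Cmod (z - p)%C < d -> Cmod z <= rho -> Q z d) ->
  exists d, 0 < d /\ forall z, Cmod z <= rho -> Q z d.
Proof.
  intros Hmon Hloc.
  assert (Hall : forall u v : R, exists d : posreal, forall z,
            Cmod (z - (u, v))%C < 2 * d -> Cmod z <= rho -> Q z d).
  { intros u v; destruct (Rle_or_lt (Cmod (u, v)) rho) as [H|H].
    - destruct (Hloc _ H) as [d [Hd HQ]].
      assert (Hd2 : 0 < d / 2) by lra.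
      exists (mkposreal _ Hd2); simpl; intros z Hz Hr.
      apply Hmon with d; [lra|]; apply HQ; [lra|exact Hr].
    - assert (Hd2 : 0 < (Cmod (u, v) - rho) / 2) by lra.
      (* around a centre outside the disk, take a ball that misses the disk *)
      exists (mkposreal _ Hd2); simpl; intros z Hz Hr; exfalso.
      pose proof (Cmod_le_Cmod_minus (u, v) z) as T; lra. }
  set (delta := fun u v => proj1_sig (constructive_indefinite_description _ (Hall u v))).
  destruct (compactness_value_2d (- rho) rho (- rho) rho delta) as [d Hd].
  exists d; split; [apply cond_pos|]; intros z Hz.
  pose proof (Rmax_Cmod z) as Hm.
  pose proof (Rmax_l (Rabs (fst z)) (Rabs (snd z))).
  pose proof (Rmax_r (Rabs (fst z)) (Rabs (snd z))).
  pose proof (Rabs_le_between (fst z) rho) as [B1 _].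
  pose proof (Rabs_le_between (snd z) rho) as [B2 _].
  destruct (NNPP _ (Hd (fst z) (snd z) (B1 ltac:(lra)) (B2 ltac:(lra))))
    as [u [v [_ [_ [H1 [H2 H3]]]]]].
  apply Hmon with (delta u v); [exact H3|].
  apply (proj2_sig (constructive_indefinite_description _ (Hall u v))); [|exact Hz].
  now apply Cmod_lt_coords.
Qed.

(** Upper semicontinuity suffices. Compactness is used twice: with [u <= 1 / e] to bound
    [u], then, if the supremum [M] were not attained, with [u <= M - e] for a
    contradiction. *)
Lemma disk_attains_max (rho : R) (u : C -> R) :
  0 <= rho ->
  (forall p, Cmod p <= rho -> forall e, 0 < e -> exists d, 0 < d /\
     forall z, Cmod (z - p)%C < d -> u z < u p + e) ->
  exists z0, Cmod z0 <= rho /\ forall z, Cmod z <= rho -> u z <= u z0.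
Proof.
  intros Hrho Hu.
  destruct (disk_compact rho (fun z d => u z <= / d /\ 0 < d \/ d <= 0)) as [d [Hd HB]].
  { intros z e e' He [[H1 H2]|H]; [|right; lra].
    destruct (Rle_or_lt e' 0) as [H|H]; [now right|left].
    split; [|exact H]; eapply Rle_trans; [exact H1|].
    apply Rinv_le_contravar; assumption. }
  { intros p Hp; destruct (Hu p Hp 1 Rlt_0_1) as [d [Hd HQ]].
    assert (Hq : 0 < / (Rabs (u p) + 1))
      by (apply Rinv_0_lt_compat; pose proof (Rabs_pos (u p)); lra).
    exists (Rmin d (/ (Rabs (u p) + 1))).
    assert (Hm : 0 < Rmin d (/ (Rabs (u p) + 1))) by now apply Rmin_pos.
    pose proof (Rmin_l d (/ (Rabs (u p) + 1))).
    pose proof (Rmin_r d (/ (Rabs (u p) + 1))) as Hr.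
    split; [exact Hm|]; intros z Hz _; left; split; [|exact Hm].
    apply Rle_trans with (Rabs (u p) + 1).
    - specialize (HQ z ltac:(lra)); pose proof (Rle_abs (u p)); lra.
    - rewrite <- (Rinv_inv (Rabs (u p) + 1)) at 1; now apply Rinv_le_contravar. }
  destruct (completeness (fun x => exists z, Cmod z <= rho /\ x = u z)) as [M [HM1 HM2]].
  { exists (/ d); intros x [z [Hz ->]]; destruct (HB z Hz) as [[H _]|H]; [exact H|lra]. }
  { exists (u 0%C), 0%C; split; [rewrite Cmod_0; exact Hrho|reflexivity]. }
  destruct (classic (exists z0, Cmod z0 <= rho /\ M <= u z0)) as [[z0 [H0 H1]]|Hno].
  { exists z0; split; [exact H0|]; intros z Hz.
    eapply Rle_trans; [apply HM1; exists z; auto|exact H1]. }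
  exfalso.
  destruct (disk_compact rho (fun z d => u z <= M - d)) as [d' [Hd' HB']].
  { intros z e e' He H; lra. }
  { intros p Hp.
    assert (Hlt : 0 < (M - u p) / 2).
    { destruct (Rlt_or_le (u p) M) as [H|H]; [lra|exfalso; apply Hno; exists p; auto]. }
    destruct (Hu p Hp _ Hlt) as [e [He HQ]].
    exists (Rmin e ((M - u p) / 2)); split; [now apply Rmin_pos|].
    pose proof (Rmin_l e ((M - u p) / 2)); pose proof (Rmin_r e ((M - u p) / 2)).
    intros z Hz _; specialize (HQ z ltac:(lra)); lra. }
  assert (M <= M - d'); [|lra].
  apply HM2; intros x [z [Hz ->]]; auto.
Qed.

(** A local substitute for analyticity that passes to products and quotients by a direct
    computation, and is strong enough for the maximum principle. *)
Definition smooth2 (phi : C -> C) (z0 : C) : Prop :=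
  exists a1 a2 : C, Jet (fun h => phi (z0 + h)%C) (phi z0) a1 a2.

Lemma smooth2_near (phi : C -> C) (z0 : C) (e : R) :
  smooth2 phi z0 -> 0 < e ->
  exists d, 0 < d /\ forall z, Cmod (z - z0)%C < d -> Cmod (phi z - phi z0)%C < e.
Proof.
  intros [a1 [a2 HJ]] He.
  destruct (Jet_near _ _ _ _ _ HJ He) as [d [Hd H]].
  exists d; split; [exact Hd|]; intros z Hz.
  destruct (Ceq_dec z z0) as [->|n].
  - replace (phi z0 - phi z0)%C with (RtoC 0) by ring; rewrite Cmod_0; exact He.
  - replace z with (z0 + (z - z0))%C by ring; apply H; split; [|exact Hz].
    apply Cmod_gt_0; intros E; apply n, Cminus_eq_0, E.
Qed.

Lemma Cmod_sq_sum (a b : C) :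
  Cmod (a + b)%C ^ 2 + Cmod (a - b)%C ^ 2 = 2 * Cmod a ^ 2 + 2 * Cmod b ^ 2.
Proof.
  rewrite !Cmod2_alt; destruct a, b; unfold Re, Im, Cminus, Cplus, Copp; simpl; ring.
Qed.

(** The sub-mean-value property of [|P|^2] on the square [h, -h, ih, -ih]: the cross terms
    between [1], [h] and [h^2] cancel in the sum. *)
Lemma four_point_mean (a0 a1 a2 : C) (x : R) :
  let P (h : C) := (a0 + a1 * h + a2 * h ^ 2)%C in
  4 * Cmod a0 ^ 2 <=
  Cmod (P (RtoC x)) ^ 2 + Cmod (P (- RtoC x)%C) ^ 2
  + (Cmod (P (Ci * RtoC x)%C) ^ 2 + Cmod (P (- (Ci * RtoC x))%C) ^ 2).
Proof.
  intros P; unfold P.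
  assert (Hi : (Ci * Ci = - 1)%C) by (unfold Ci, Cmult, Copp, RtoC; simpl; f_equal; ring).
  replace (a0 + a1 * x + a2 * x ^ 2)%C with ((a0 + a2 * x ^ 2) + a1 * x)%C by ring.
  replace (a0 + a1 * - x + a2 * (- x) ^ 2)%C with ((a0 + a2 * x ^ 2) - a1 * x)%C by ring.
  replace (a0 + a1 * (Ci * x) + a2 * (Ci * x) ^ 2)%C
    with ((a0 - a2 * x ^ 2) + a1 * (Ci * x))%C
    by (replace ((Ci * x) ^ 2)%C with ((Ci * Ci) * x ^ 2)%C by ring; rewrite Hi; ring).
  replace (a0 + a1 * - (Ci * x) + a2 * (- (Ci * x)) ^ 2)%C
    with ((a0 - a2 * x ^ 2) - a1 * (Ci * x))%C
    by (replace ((- (Ci * x)) ^ 2)%C with ((Ci * Ci) * x ^ 2)%C by ring; rewrite Hi; ring).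
  rewrite !Cmod_sq_sum.
  pose proof (Cmod_sq_sum a0 (a2 * x ^ 2)) as H.
  pose proof (pow2_ge_0 (Cmod (a1 * x)%C)).
  pose proof (pow2_ge_0 (Cmod (a1 * (Ci * x))%C)).
  pose proof (pow2_ge_0 (Cmod (a2 * x ^ 2)%C)).
  lra.
Qed.

Lemma Cmod_sq_perturb (p e : C) (M d : R) :
  Cmod p <= M -> Cmod e <= d -> Cmod p ^ 2 - 2 * M * d <= Cmod (p + e)%C ^ 2.
Proof.
  intros Hp He.
  pose proof (Cmod_triangle (p + e) (- e)) as T.
  replace (p + e + - e)%C with p in T by ring; rewrite Cmod_opp in T.
  pose proof (Cmod_ge_0 p); pose proof (Cmod_ge_0 e); pose proof (Cmod_ge_0 (p + e)%C).
  destruct (Rle_or_lt (Cmod p) (Cmod e)); nra.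
Qed.

(** Averaging over four points at distance [x] from [z0], the term [e |z|^2] gains
    [e x^2], [|phi|^2] loses at most the cubic remainder, and the former wins for small
    [x]. *)
Lemma no_interior_max (phi : C -> C) (z0 : C) (e d : R) :
  smooth2 phi z0 -> 0 < e -> 0 < d ->
  exists z, Cmod (z - z0)%C < d /\
    Cmod (phi z0) ^ 2 + e * Cmod z0 ^ 2 < Cmod (phi z) ^ 2 + e * Cmod z ^ 2.
Proof.
  intros [a1 [a2 [E [[K0 HK0] HJ]]]] He Hd.
  set (K := Rabs K0).
  assert (HK : near0 (fun h => Cmod (E h) <= K)).
  { revert HK0; apply near0_imp; intros h Hh; unfold K; pose proof (Rle_abs K0); lra. }
  set (P := fun h => (phi z0 + a1 * h + a2 * h ^ 2)%C).
  set (M := Cmod (phi z0) + Cmod a1 + Cmod a2).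
  assert (HM : forall h, Cmod h < 1 -> Cmod (P h) <= M).
  { intros h Hh; unfold P, M.
    eapply Rle_trans; [apply Cmod_triangle|]; apply Rplus_le_compat.
    - eapply Rle_trans; [apply Cmod_triangle|]; apply Rplus_le_compat_l.
      rewrite Cmod_mult; pose proof (Cmod_ge_0 a1); nra.
    - rewrite Cmod_mult, Cmod_pow; pose proof (Cmod_ge_0 a2); pose proof (Cmod_ge_0 h).
      assert (Cmod h ^ 2 <= 1) by (simpl; nra); nra. }
  assert (HM0 : 0 <= M)
    by (unfold M; pose proof (Cmod_ge_0 (phi z0)); pose proof (Cmod_ge_0 a1);
        pose proof (Cmod_ge_0 a2); lra).
  assert (HKp : 0 <= K) by apply Rabs_pos.
  destruct (near0_and _ _ HK HJ) as [r [Hr HR]].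
  assert (Hq : 0 < e / (2 * M * K + 1)) by (apply Rdiv_lt_0_compat; nra).
  set (m := Rmin (Rmin r 1) (Rmin d (e / (2 * M * K + 1)))).
  assert (Hm : 0 < m) by (repeat apply Rmin_pos; lra).
  assert (Hmr : m <= r /\ m <= 1 /\ m <= d /\ m <= e / (2 * M * K + 1)).
  { pose proof (Rmin_l (Rmin r 1) (Rmin d (e / (2 * M * K + 1)))).
    pose proof (Rmin_r (Rmin r 1) (Rmin d (e / (2 * M * K + 1)))).
    pose proof (Rmin_l r 1). pose proof (Rmin_r r 1).
    pose proof (Rmin_l d (e / (2 * M * K + 1))). pose proof (Rmin_r d (e / (2 * M * K + 1))).
    unfold m; repeat split; lra. }
  destruct Hmr as [M1 [M2 [M3 M4]]].
  set (x := m / 2). assert (Hx : 0 < x < m) by (unfold x; lra).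
  assert (Hsmall : 2 * M * K * x < e).
  { apply Rle_lt_trans with ((2 * M * K + 1) * x).
    - nra.
    - apply Rlt_le_trans with ((2 * M * K + 1) * (e / (2 * M * K + 1))).
      + apply Rmult_lt_compat_l; [nra|lra].
      + right; field; nra. }
  assert (Hlow : forall h, Cmod h = x ->
     Cmod (P h) ^ 2 - 2 * M * (x ^ 3 * K) <= Cmod (phi (z0 + h)%C) ^ 2).
  { intros h Hh; destruct (HR h ltac:(lra)) as [H1 H2]; rewrite H2.
    apply (Cmod_sq_perturb (P h)); [apply HM; lra|].
    rewrite Cmod_mult, Cmod_pow, Hh.
    apply Rmult_le_compat_l; [apply pow_le; lra|exact H1]. }
  assert (Hh1 : Cmod (RtoC x) = x) by (rewrite Cmod_R, Rabs_pos_eq; lra).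
  assert (Hh2 : Cmod (- RtoC x)%C = x) by now rewrite Cmod_opp.
  assert (Hh3 : Cmod (Ci * RtoC x)%C = x) by (rewrite Cmod_mult, Cmod_Ci; lra).
  assert (Hh4 : Cmod (- (Ci * RtoC x))%C = x) by now rewrite Cmod_opp.
  apply NNPP; intros Hno.
  assert (Hup : forall h, Cmod h = x ->
     Cmod (phi (z0 + h)%C) ^ 2 + e * Cmod (z0 + h)%C ^ 2
     <= Cmod (phi z0) ^ 2 + e * Cmod z0 ^ 2).
  { intros h Hh; apply Rnot_lt_le; intros Hlt; apply Hno.
    exists (z0 + h)%C; split; [|exact Hlt].
    replace (z0 + h - z0)%C with h by ring; lra. }
  pose proof (four_point_mean (phi z0) a1 a2 x) as HMean; cbv zeta in HMean.
  pose proof (Hlow _ Hh1) as L1; pose proof (Hlow _ Hh2) as L2.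
  pose proof (Hlow _ Hh3) as L3; pose proof (Hlow _ Hh4) as L4.
  unfold P in L1, L2, L3, L4.
  pose proof (Hup _ Hh1) as U1; pose proof (Hup _ Hh2) as U2.
  pose proof (Hup _ Hh3) as U3; pose proof (Hup _ Hh4) as U4.
  pose proof (Cmod_sq_sum z0 x) as S1; pose proof (Cmod_sq_sum z0 (Ci * x)) as S2.
  rewrite Hh1 in S1; rewrite Hh3 in S2; unfold Cminus in S1, S2.
  assert (HS : Cmod (z0 + x)%C ^ 2 + Cmod (z0 + - x)%C ^ 2
      + Cmod (z0 + Ci * x)%C ^ 2 + Cmod (z0 + - (Ci * x))%C ^ 2
      = 4 * Cmod z0 ^ 2 + 4 * x ^ 2) by lra.
  apply (f_equal (Rmult e)) in HS; rewrite !Rmult_plus_distr_l in HS.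
  assert (Hfin : e * (4 * x ^ 2) <= 4 * (2 * M * (x ^ 3 * K))) by lra.
  assert (Hx2 : 0 < x ^ 2) by (apply pow_lt; lra).
  replace (4 * (2 * M * (x ^ 3 * K))) with (2 * M * K * x * (4 * x ^ 2)) in Hfin by ring.
  nra.
Qed.

(** The function [|phi|^2 + e |z|^2] attains its maximum over the closed disk, and does so
    on the boundary circle by [no_interior_max]; then [e] tends to [0]. *)
Lemma maximum_principle (phi : C -> C) (rho B : R) :
  0 <= rho -> 0 <= B ->
  (forall z, Cmod z <= rho -> smooth2 phi z) ->
  (forall z, Cmod z = rho -> Cmod (phi z) <= B) ->
  forall z, Cmod z <= rho -> Cmod (phi z) <= B.
Proof.
  intros Hrho HB Hs Hb z Hz.
  assert (Hsq : Cmod (phi z) ^ 2 <= B ^ 2).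
  { apply le_epsilon; intros e0 He0.
    set (e := e0 / (rho ^ 2 + 1)).
    assert (Hr2 : 0 <= rho ^ 2) by apply pow2_ge_0.
    assert (He : 0 < e) by (apply Rdiv_lt_0_compat; lra).
    destruct (disk_attains_max rho (fun z => Cmod (phi z) ^ 2 + e * Cmod z ^ 2) Hrho)
      as [z0 [Hz0 Hmax]].
    { intros p Hp t Ht.
      set (A := 2 * Cmod (phi p) + 1 + e * (2 * Cmod p + 1)).
      pose proof (Cmod_ge_0 (phi p)); pose proof (Cmod_ge_0 p).
      assert (HA : 1 <= A) by (unfold A; nra).
      assert (Hq : 0 < Rmin 1 (t / A))
        by (apply Rmin_pos; [lra|apply Rdiv_lt_0_compat; lra]).
      destruct (smooth2_near _ _ _ (Hs p Hp) Hq) as [d [Hd HQ]].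
      exists (Rmin d (Rmin 1 (t / A))); split; [now apply Rmin_pos|].
      intros w Hw.
      pose proof (Rmin_l d (Rmin 1 (t / A))); pose proof (Rmin_r d (Rmin 1 (t / A))).
      specialize (HQ w ltac:(lra)).
      pose proof (Rmin_l 1 (t / A)); pose proof (Rmin_r 1 (t / A)).
      assert (HtA : A * Rmin 1 (t / A) <= t).
      { apply Rle_trans with (A * (t / A)); [apply Rmult_le_compat_l; lra|].
        right; field; lra. }
      set (q := Rmin 1 (t / A)) in *.
      pose proof (Cmod_triangle (phi p) (phi w - phi p)) as T1.
      replace (phi p + (phi w - phi p))%C with (phi w) in T1 by ring.
      pose proof (Cmod_triangle p (w - p)) as T2.
      replace (p + (w - p))%C with w in T2 by ring.
      pose proof (Cmod_ge_0 (phi w)); pose proof (Cmod_ge_0 w).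
      assert (G : forall a b, 0 <= a -> 0 <= b -> b < a + q -> b ^ 2 < a ^ 2 + (2 * a + 1) * q)
        by (intros a b Ha Hb' Hab; nra).
      pose proof (G (Cmod (phi p)) (Cmod (phi w)) ltac:(lra) ltac:(lra) ltac:(lra)).
      pose proof (G (Cmod p) (Cmod w) ltac:(lra) ltac:(lra) ltac:(lra)).
      unfold A in HtA; nra. }
    assert (Hbd : Cmod z0 = rho).
    { destruct (Req_dec (Cmod z0) rho) as [H|H]; [exact H|exfalso].
      destruct (no_interior_max phi z0 e (rho - Cmod z0) (Hs _ Hz0) He ltac:(lra))
        as [w [Hw1 Hw2]].
      assert (Hw : Cmod w <= rho).
      { pose proof (Cmod_triangle z0 (w - z0)) as T.
        replace (z0 + (w - z0))%C with w in T by ring; lra. }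
      specialize (Hmax w Hw); lra. }
    specialize (Hmax z Hz); specialize (Hb z0 Hbd); rewrite Hbd in Hmax.
    pose proof (Cmod_ge_0 (phi z0)).
    assert (Cmod (phi z0) ^ 2 <= B ^ 2) by (apply pow_incr; lra).
    assert (e * rho ^ 2 <= e0).
    { unfold e; apply Rmult_le_reg_r with (rho ^ 2 + 1); [lra|].
      replace (e0 / (rho ^ 2 + 1) * rho ^ 2 * (rho ^ 2 + 1)) with (e0 * rho ^ 2)
        by (field; lra); nra. }
    pose proof (pow2_ge_0 (Cmod z)); nra. }
  apply Rsqr_incr_0_var; [unfold Rsqr; simpl in Hsq; lra|exact HB].
Qed.

(** On [|z| = rho] the hypothesis gives [|q| <= 1 / rho]; the maximum principle carries this
    inside, and [rho] tends to [1]. This form, stated for the quotient [q], can be applied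
    again to the next quotient. *)
Lemma schwarz (q : C -> C) :
  (forall z, in_disk z -> smooth2 q z) ->
  (forall z, in_disk z -> Cmod (z * q z)%C <= 1) ->
  forall z, in_disk z -> Cmod (q z) <= 1.
Proof.
  unfold in_disk; intros Hs Hb z Hz.
  pose proof (Cmod_ge_0 z).
  assert (HR : forall rho, Cmod z <= rho -> 0 < rho < 1 -> Cmod (q z) <= / rho).
  { intros rho H1 H2; apply (maximum_principle q rho); [lra| | | |exact H1].
    - apply Rlt_le, Rinv_0_lt_compat; lra.
    - intros w Hw; apply Hs; lra.
    - intros w Hw; specialize (Hb w ltac:(lra)); rewrite Cmod_mult, Hw in Hb.
      apply Rmult_le_reg_l with rho; [lra|]; rewrite Rinv_r; lra. }
  apply Rnot_lt_le; intros Hlt.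
  assert (Hi : 0 < / Cmod (q z) < 1).
  { split; [apply Rinv_0_lt_compat; lra|].
    rewrite <- Rinv_1; apply Rinv_lt_contravar; lra. }
  set (m := Rmax (Cmod z) (/ Cmod (q z))).
  assert (Hm : m < 1) by (apply Rmax_lub_lt; lra).
  assert (Cmod z <= m) by apply Rmax_l.
  assert (/ Cmod (q z) <= m) by apply Rmax_r.
  specialize (HR ((m + 1) / 2) ltac:(lra) ltac:(lra)).
  assert (/ ((m + 1) / 2) < / / Cmod (q z))
    by (apply Rinv_lt_contravar; [apply Rmult_lt_0_compat; lra|lra]).
  rewrite Rinv_inv in *; lra.
Qed.

(** [|1 - conj(b) a|^2 - |a - b|^2 = (1 - |a|^2) (1 - |b|^2)]. *)
Lemma Mobius_le (a b : C) :
  Cmod a <= 1 -> Cmod b <= 1 -> Cmod (a - b)%C <= Cmod (1 - Cconj b * a)%C.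
Proof.
  intros Ha Hb.
  apply Rsqr_incr_0_var; [|apply Cmod_ge_0].
  assert (H : Cmod (1 - Cconj b * a)%C ^ 2 - Cmod (a - b)%C ^ 2
              = (1 - Cmod a ^ 2) * (1 - Cmod b ^ 2)).
  { rewrite !Cmod2_alt; destruct a, b;
      unfold Re, Im, Cminus, Cplus, Copp, Cmult, Cconj, RtoC; simpl; ring. }
  assert (Cmod a ^ 2 <= 1) by (pose proof (Cmod_ge_0 a); simpl; nra).
  assert (Cmod b ^ 2 <= 1) by (pose proof (Cmod_ge_0 b); simpl; nra).
  assert (0 <= (1 - Cmod a ^ 2) * (1 - Cmod b ^ 2)) by (apply Rmult_le_pos; lra).
  unfold Rsqr; simpl in *; lra.
Qed.

Lemma near0_translate_neq0 (z : C) : z <> 0%C -> near0 (fun h => (z + h)%C <> 0%C).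
Proof.
  intros Hz; assert (H : 0 < Cmod z) by now apply Cmod_gt_0.
  generalize (near0_small _ H); apply near0_imp; intros h Hh E.
  replace h with (- z)%C in Hh by (replace h with (z + h - z)%C by ring; rewrite E; ring).
  rewrite Cmod_opp in Hh; lra.
Qed.

(** Two applications of [schwarz]. The first bounds [phi = omega / z] by [1]. The second
    bounds the quotient by [z] of the Moebius transform of [phi] that sends [phi 0 = c1] to
    [0]; its value at [0] is [c2 / (1 - |c1|^2)]. *)
Lemma schwarz_function_coef (omega : C -> C) :
  analytic_on_disk omega -> omega 0%C = 0%C ->
  (forall z, in_disk z -> Cmod (omega z) < 1) ->
  exists c1 c2 : C, Jet omega 0 c1 c2 /\ Cmod c2 <= 1 - Cmod c1 ^ 2.
Proof.
  intros Han H0 Hlt.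
  assert (D0 : in_disk 0%C) by (unfold in_disk; rewrite Cmod_0; lra).
  destruct (analytic_at_series _ _ (Han _ D0)) as [c [Hc0 Hc]]; rewrite H0 in Hc0.
  assert (Hc' : series_near0 c omega).
  { revert Hc; apply near0_imp; intros h Hh.
    now replace (0 + h)%C with h in Hh by ring. }
  exists (c 1%nat), (c 2%nat); split.
  { rewrite <- Hc0; now apply series_near0_Jet. }
  pose proof (series_near0_shift _ _ Hc') as S1.
  pose proof (series_near0_shift _ _ S1) as S2.
  set (c1 := c 1%nat) in *; set (c2 := c 2%nat) in *.
  set (phi := fun z => if Ceq_dec z 0%C then c1 else (omega z / z)%C).
  assert (phi0 : phi 0%C = c1) by (unfold phi; destruct (Ceq_dec 0%C 0%C); congruence).
  assert (phin : forall z : C, z <> 0%C -> phi z = (omega z / z)%C)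
    by (intros z Hz; unfold phi; destruct (Ceq_dec z 0%C); congruence).
  clearbody phi.
  assert (Hinvz : forall z : C, z <> 0%C -> exists a1 a2, Jet (fun h => / (z + h))%C (/ z) a1 a2)
    by (intros z Hz; eexists; eexists; apply (Jet_inv _ _ _ _ (Jet_shift z) Hz)).
  assert (Hsphi : forall z, in_disk z -> smooth2 phi z).
  { intros z Hz; destruct (Ceq_dec z 0%C) as [->|n].
    - exists c2, (c 3%nat); rewrite phi0.
      generalize (series_near0_Jet _ _ S1); apply Jet_ext.
      generalize near0_neq0; apply near0_imp; intros h Hh.
      replace (0 + h)%C with h by ring; rewrite phin, Hc0 by exact Hh; field; auto.
    - destruct (analytic_at_series _ _ (Han _ Hz)) as [d [Hd0 Hd]].
      pose proof (series_near0_Jet _ _ Hd) as HJ.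
      destruct (Hinvz z n) as [i1 [i2 Hi]].
      eexists; eexists; rewrite (phin z n), <- Hd0.
      generalize (Jet_mult _ _ _ _ _ _ _ _ HJ Hi); apply Jet_ext.
      generalize (near0_translate_neq0 z n); apply near0_imp; intros h Hh.
      now rewrite phin. }
  assert (Hphi : forall z, in_disk z -> Cmod (phi z) <= 1).
  { apply schwarz; [exact Hsphi|]; intros z Hz; destruct (Ceq_dec z 0%C) as [->|n].
    - rewrite Cmod_mult, Cmod_0; lra.
    - rewrite (phin z n); replace (z * (omega z / z))%C with (omega z) by (field; auto).
      apply Rlt_le; auto. }
  assert (Hc1 : Cmod c1 <= 1) by (rewrite <- phi0; auto).
  (* [phi] is replaced by [t phi] with [t < 1], which keeps the denominator
     [1 - conj(c1) phi] away from [0] even if [|c1| = 1]; then [t] tends to [1]. *)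
  assert (Ht : forall t, 0 < t < 1 -> t * Cmod c2 <= 1 - t ^ 2 * Cmod c1 ^ 2).
  { intros t Ht.
    set (den := fun w : C => (1 - Cconj (t * c1) * (t * w))%C).
    assert (Hsc : forall w, Cmod w <= 1 -> Cmod (t * w)%C <= t).
    { intros w Hw; rewrite Cmod_mult, Cmod_R, Rabs_pos_eq by lra.
      pose proof (Cmod_ge_0 w); nra. }
    assert (Hden : forall w, Cmod w <= 1 -> den w <> 0%C).
    { intros w Hw E; unfold den in E.
      apply Cminus_eq_0 in E; apply (f_equal Cmod) in E.
      rewrite Cmod_1, Cmod_mult, Cmod_conj in E.
      pose proof (Hsc _ Hw); pose proof (Hsc _ Hc1).
      pose proof (Cmod_ge_0 (t * c1)%C); pose proof (Cmod_ge_0 (t * w)%C); nra. }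
    assert (Hden1 : den c1 = RtoC (1 - t ^ 2 * Cmod c1 ^ 2)).
    { unfold den; rewrite Cmod2_alt; destruct c1 as [x y];
        unfold Re, Im, Cminus, Cplus, Copp, Cmult, Cconj, RtoC; simpl; f_equal; ring. }
    set (psi := fun z => if Ceq_dec z 0%C then (t * c2 * / den c1)%C
                         else (t * ((phi z - c1) / z) * / den (phi z))%C).
    assert (psi0 : psi 0%C = (t * c2 * / den c1)%C)
      by (unfold psi; destruct (Ceq_dec 0%C 0%C) as [_|n]; [reflexivity|now contradiction n]).
    assert (psin : forall z : C, z <> 0%C ->
              psi z = (t * ((phi z - c1) / z) * / den (phi z))%C)
      by (intros z Hz; unfold psi; destruct (Ceq_dec z 0%C) as [e|_]; [now contradiction e|reflexivity]).
    clearbody psi.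
    assert (Hdenphi : forall z, in_disk z -> exists a1 a2,
              Jet (fun h => / den (phi (z + h)))%C (/ den (phi z)) a1 a2).
    { intros z Hz; destruct (Hsphi z Hz) as [a1 [a2 HJ]].
      eexists; eexists; apply Jet_inv; [|apply Hden, Hphi, Hz].
      unfold den.
      eapply Jet_eq; [apply (Jet_ext (fun h => 1 + - (Cconj (t * c1) * t) * phi (z + h)))%C|..].
      - exists 1; split; [lra|]; intros; ring.
      - apply Jet_plus; [apply Jet_const|apply Jet_scal, HJ].
      - ring.
      - reflexivity.
      - reflexivity. }
    assert (Hpsi : Cmod (psi 0%C) <= 1).
    { apply schwarz; [..|exact D0].
      - intros z Hz; destruct (Hdenphi z Hz) as [e1 [e2 He]].
        destruct (Ceq_dec z 0%C) as [->|n].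
        + eexists; eexists; rewrite psi0; rewrite phi0 in He.
          generalize (Jet_mult _ _ _ _ _ _ _ _
             (Jet_scal t _ _ _ _ (series_near0_Jet _ _ S2)) He); apply Jet_ext.
          generalize near0_neq0; apply near0_imp; intros h Hh.
          replace (0 + h)%C with h by ring.
          rewrite psin by exact Hh; rewrite (phin h) by exact Hh.
          rewrite Hc0; fold c1; do 2 f_equal; field; auto.
        + destruct (Hsphi z Hz) as [a1 [a2 HJ]].
          destruct (Hinvz z n) as [i1 [i2 Hi]].
          eexists; eexists; rewrite (psin z n).
          generalize (Jet_mult _ _ _ _ _ _ _ _ (Jet_scal t _ _ _ _
             (Jet_mult _ _ _ _ _ _ _ _ (Jet_plus _ _ _ _ _ _ _ _ HJ (Jet_const (- c1)%C)) Hi)) He).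
          apply Jet_ext.
          generalize (near0_translate_neq0 z n); apply near0_imp; intros h Hh.
          now rewrite psin.
      - intros z Hz; destruct (Ceq_dec z 0%C) as [->|n].
        + rewrite Cmod_mult, Cmod_0; lra.
        + rewrite (psin z n).
          pose proof (Hden _ (Hphi z Hz)) as Hd.
          replace (z * (t * ((phi z - c1) / z) * / den (phi z)))%C
            with ((t * phi z - t * c1) / den (phi z))%C by (field; auto).
          rewrite Cmod_div by exact Hd.
          assert (Hp : 0 < Cmod (den (phi z))) by now apply Cmod_gt_0.
          apply Rmult_le_reg_r with (Cmod (den (phi z))); [exact Hp|].
          unfold Rdiv; rewrite Rmult_assoc, Rinv_l, Rmult_1_r, Rmult_1_l by lra.
          pose proof (Hsc _ (Hphi z Hz)); pose proof (Hsc _ Hc1).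
          unfold den; apply Mobius_le; lra. }
    rewrite psi0, Cmod_mult, Cmod_inv, Cmod_mult in Hpsi by (apply Hden, Hc1).
    rewrite Hden1, !Cmod_R in Hpsi.
    assert (Hpos : 0 < 1 - t ^ 2 * Cmod c1 ^ 2).
    { pose proof (Cmod_ge_0 c1); assert (Cmod c1 ^ 2 <= 1) by (simpl; nra).
      assert (0 < t ^ 2 < 1) by (simpl; nra); nra. }
    rewrite !Rabs_pos_eq in Hpsi by lra.
    apply Rmult_le_reg_r with (/ (1 - t ^ 2 * Cmod c1 ^ 2));
      [now apply Rinv_0_lt_compat|]; rewrite Rinv_r by lra; exact Hpsi. }
  apply Rnot_lt_le; intros Hlt2.
  set (g := Cmod c2 - (1 - Cmod c1 ^ 2)).
  assert (Hg : 0 < g) by (unfold g; lra).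
  pose proof (Cmod_ge_0 c2); pose proof (Cmod_ge_0 c1).
  assert (Hcc : Cmod c1 ^ 2 <= 1) by (simpl; nra).
  (* [1 - k] is a value of [t] so close to [1] that the inequality just proved
     contradicts a gap [g > 0]. *)
  set (k := g / (2 * (Cmod c2 + 2 + g))).
  assert (Hk : k * (2 * (Cmod c2 + 2 + g)) = g) by (unfold k; field; lra).
  assert (Hk01 : 0 < k < 1) by (split; nra).
  pose proof (Ht (1 - k) ltac:(lra)) as Hf.
  unfold g in Hk; nra.
Qed.

(** * The exponential and the coefficient relations *)

(** Mean value theorem. Started from a bound on the last derivative, it gives the Taylor
    remainders of [exp], [sin] and [cos] one order at a time. *)
Lemma integrate_bound (G g : R -> R) (K : R) (n : nat) :
  0 <= K -> G 0 = 0 -> (forall x, is_derive G x (g x)) ->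
  (forall x, Rabs x <= 1 -> Rabs (g x) <= K * Rabs x ^ n) ->
  forall x, Rabs x <= 1 -> Rabs (G x) <= K * Rabs x ^ S n.
Proof.
  intros HK G0 HG Hg x Hx.
  destruct (MVT_gen G 0 x g) as [xi [Hxi He]].
  - intros; apply HG.
  - intros y _; apply continuity_pt_filterlim.
    apply (ex_derive_continuous G); exists (g y); apply HG.
  - rewrite G0 in He; replace (G x) with (g xi * x) by lra.
    assert (Hle : Rabs xi <= Rabs x).
    { revert Hxi; unfold Rmin, Rmax, Rabs.
      destruct (Rle_dec 0 x), (Rcase_abs xi), (Rcase_abs x); lra. }
    rewrite Rabs_mult; simpl.
    rewrite (Rmult_comm (Rabs x)), <- Rmult_assoc.
    apply Rmult_le_compat_r; [apply Rabs_pos|].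
    eapply Rle_trans; [apply Hg; lra|].
    apply Rmult_le_compat_l; [exact HK|].
    apply pow_incr; split; [apply Rabs_pos|exact Hle].
Qed.

Lemma exp_taylor2 (x : R) :
  Rabs x <= 1 -> Rabs (exp x - 1 - x - x ^ 2 / 2) <= 3 * Rabs x ^ 3.
Proof.
  apply (integrate_bound (fun x => exp x - 1 - x - x ^ 2 / 2) (fun x => exp x - 1 - x)).
  - lra.
  - rewrite exp_0; field.
  - intros y; auto_derive; [auto|simpl; field].
  - apply (integrate_bound (fun x => exp x - 1 - x) (fun x => exp x - 1)).
    + lra.
    + rewrite exp_0; ring.
    + intros y; auto_derive; [auto|ring].
    + apply (integrate_bound (fun x => exp x - 1) exp).
      * lra.
      * rewrite exp_0; ring.
      * intros y; auto_derive; [auto|ring].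
      * intros y Hy; rewrite Rabs_pos_eq by (left; apply exp_pos).
        apply Rle_trans with (exp 1); [|simpl; pose proof exp_le_3; lra].
        apply Rabs_le_between in Hy.
        destruct (Req_dec y 1) as [->|]; [lra|left; apply exp_increasing; lra].
Qed.

Lemma sin_cos_taylor2 (x : R) :
  Rabs x <= 1 ->
  Rabs (sin x - x) <= Rabs x ^ 3 /\ Rabs (cos x - 1 + x ^ 2 / 2) <= Rabs x ^ 3.
Proof.
  assert (S0 : forall x, Rabs x <= 1 -> Rabs (- sin x) <= 1 * Rabs x ^ 1).
  { apply (integrate_bound (fun x => - sin x) (fun x => - cos x) 1 0).
    - lra.
    - rewrite sin_0; ring.
    - intros y; auto_derive; [auto|ring].
    - intros y _; rewrite Rabs_Ropp; simpl; rewrite Rmult_1_r.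
      apply Rabs_le, COS_bound. }
  assert (C0 : forall x, Rabs x <= 1 -> Rabs (cos x - 1) <= 1 * Rabs x ^ 2).
  { apply (integrate_bound (fun x => cos x - 1) (fun x => - sin x) 1 1); [| | |exact S0].
    - lra.
    - rewrite cos_0; ring.
    - intros y; auto_derive; [auto|ring]. }
  assert (S1 : forall x, Rabs x <= 1 -> Rabs (sin x - x) <= 1 * Rabs x ^ 3).
  { apply (integrate_bound (fun x => sin x - x) (fun x => cos x - 1) 1 2); [| | |exact C0].
    - lra.
    - rewrite sin_0; ring.
    - intros y; auto_derive; [auto|ring]. }
  assert (C1 : forall x, Rabs x <= 1 -> Rabs (- (cos x - 1 + x ^ 2 / 2)) <= 1 * Rabs x ^ 4).
  { apply (integrate_bound (fun x => - (cos x - 1 + x ^ 2 / 2)) (fun x => sin x - x) 1 3);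
      [| | |exact S1].
    - lra.
    - rewrite cos_0; field.
    - intros y; auto_derive; [auto|simpl; field]. }
  intros Hx; split; [specialize (S1 x Hx); lra|].
  specialize (C1 x Hx); rewrite Rabs_Ropp in C1.
  assert (0 <= Rabs x ^ 3) by apply pow_le, Rabs_pos.
  pose proof (Rabs_pos x); simpl in *; nra.
Qed.

Lemma Jet_Cexp : Jet Cexp 1 1 (/ 2).
Proof.
  apply (Jet_intro _ _ _ _ 20); generalize (near0_small 1 Rlt_0_1); apply near0_imp.
  intros [x y] Hs; set (s := Cmod (x, y)) in *.
  assert (Hxs : Rabs x <= s /\ Rabs y <= s).
  { pose proof (Rmax_Cmod (x, y)) as Hm; simpl in Hm; fold s in Hm.
    pose proof (Rmax_l (Rabs x) (Rabs y)); pose proof (Rmax_r (Rabs x) (Rabs y)); lra. }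
  destruct Hxs as [Hx Hy].
  assert (Hs0 : 0 <= s) by apply Cmod_ge_0.
  pose proof (exp_taylor2 x ltac:(lra)) as He.
  destruct (sin_cos_taylor2 y ltac:(lra)) as [HS HC].
  set (e := exp x - 1 - x - x ^ 2 / 2) in He.
  set (u := sin y - y) in HS; set (c := cos y - 1 + y ^ 2 / 2) in HC.
  set (s3 := s ^ 3).
  assert (Hx3 : Rabs x ^ 3 <= s3) by (apply pow_incr; split; [apply Rabs_pos|lra]).
  assert (Hy3 : Rabs y ^ 3 <= s3) by (apply pow_incr; split; [apply Rabs_pos|lra]).
  assert (Hs3 : 0 <= s3) by now apply pow_le.
  assert (He' : Rabs e <= 3 * s3) by lra.
  assert (Hu' : Rabs u <= s3) by lra.
  assert (Hc' : Rabs c <= s3) by lra.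
  assert (HPx : Rabs (1 + x + x ^ 2 / 2) <= 5 / 2).
  { apply Rabs_le_between in Hx; apply Rabs_le; split; nra. }
  assert (Hcy : Rabs (cos y) <= 1) by apply Rabs_le, COS_bound.
  assert (Hsy : Rabs (sin y) <= 1) by apply Rabs_le, SIN_bound.
  assert (HM : forall a b A B, Rabs a <= A -> Rabs b <= B -> Rabs (a * b) <= A * B).
  { intros a b A B Ha Hb; rewrite Rabs_mult; apply Rmult_le_compat; auto using Rabs_pos. }
  assert (Hxyy : Rabs (x * (y * y)) <= s3).
  { replace s3 with (s * (s * s)) by (unfold s3; ring); auto. }
  assert (Hxxy : Rabs (x * (x * y)) <= s3).
  { replace s3 with (s * (s * s)) by (unfold s3; ring); auto. }
  assert (Hx1 : Rabs x <= 1) by lra.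
  pose proof (HM _ _ _ _ He' Hcy) as T1; pose proof (HM _ _ _ _ HPx Hc') as T2.
  pose proof (HM _ _ _ _ He' Hsy) as T3; pose proof (HM _ _ _ _ HPx Hu') as T4.
  pose proof (HM _ _ _ _ Hx1 Hxyy) as T5.
  replace (Cexp (x, y) - (1 + 1 * (x, y) + / 2 * (x, y) ^ 2))%C
    with (RtoC (e * cos y + (1 + x + x ^ 2 / 2) * c - x * (y * y) / 2 - x * (x * (y * y)) / 4)
      + Ci * RtoC (e * sin y + (1 + x + x ^ 2 / 2) * u + x * (x * y) / 2))%C.
  2:{ unfold e, u, c, Cexp, Re, Im, Ci, Cminus, Cplus, Copp, Cmult, Cinv, RtoC; simpl.
      f_equal; field. }
  eapply Rle_trans; [apply Cmod_triangle|].
  rewrite Cmod_mult, Cmod_Ci, !Cmod_R.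
  apply Rabs_le_between in T1; apply Rabs_le_between in T2; apply Rabs_le_between in T3;
  apply Rabs_le_between in T4; apply Rabs_le_between in T5;
  apply Rabs_le_between in Hxyy; apply Rabs_le_between in Hxxy.
  assert (R1 : Rabs (e * cos y + (1 + x + x ^ 2 / 2) * c - x * (y * y) / 2 - x * (x * (y * y)) / 4) <= 10 * s3)
    by (apply Rabs_le; split; lra).
  assert (R2 : Rabs (e * sin y + (1 + x + x ^ 2 / 2) * u + x * (x * y) / 2) <= 10 * s3)
    by (apply Rabs_le; split; lra).
  lra.
Qed.

Lemma Cexp_0 : Cexp 0%C = 1%C.
Proof. unfold Cexp, RtoC; simpl; rewrite exp_0, cos_0, sin_0; f_equal; ring. Qed.

Lemma Jet_Cexp_comp (L : C -> C) (l1 l2 : C) :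
  Jet L 0 l1 l2 -> Jet (fun h => Cexp (L h)) 1 l1 (l2 + l1 ^ 2 / 2)%C.
Proof.
  intros HL; eapply Jet_eq; [apply (Jet_comp _ _ _ _ _ _ _ Jet_Cexp Cexp_0 HL)|..].
  - reflexivity.
  - ring.
  - field.
Qed.

Lemma near0_in_disk : near0 in_disk.
Proof. exact (near0_small 1 Rlt_0_1). Qed.

Lemma analytic_Jet_0 (F : C -> C) :
  analytic_on_disk F -> exists a1 a2, Jet F (F 0%C) a1 a2.
Proof.
  intros Han; assert (D0 : in_disk 0%C) by (unfold in_disk; rewrite Cmod_0; lra).
  destruct (analytic_at_series _ _ (Han _ D0)) as [c [Hc0 Hc]].
  exists (c 1%nat), (c 2%nat); rewrite <- Hc0.
  generalize (series_near0_Jet _ _ Hc); apply Jet_ext.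
  exists 1; split; [lra|]; intros h _; f_equal; ring.
Qed.

(** Put [F1 = F / z] and let [omega] be the Schwarz function of the subordination. Clearing
    denominators turns the subordination into
    [H (1 - kappa tau omega - tau^2 omega^2) = F1 (1 + tau^2 omega^2)], and the two
    relations are the coefficients of [z] and [z^2]. The jet of the power [H] follows from
    that of its logarithm [L], which is read off [Cexp L = F']. *)
Lemma subordination_coefficients (kappa lambda : R) (F : C -> C) (b : nat -> C) :
  analytic_on_disk F -> series_near0 b F -> b 0%nat = 0%C -> b 1%nat = 1%C ->
  power_quotient_subordinate lambda F (p_tilde kappa) ->
  exists c1 c2 : C, Cmod c2 <= 1 - Cmod c1 ^ 2 /\
    (RtoC (2 * lambda - 1) * b 2%nat = RtoC (kappa * tau kappa) * c1)%C /\
    (RtoC (3 * lambda - 1) * b 3%nat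
       + RtoC (2 * lambda ^ 2 - 4 * lambda + 1) * b 2%nat ^ 2
     = RtoC (kappa * tau kappa) * c2
       + RtoC ((kappa ^ 2 + 2) * tau kappa ^ 2) * c1 ^ 2)%C.
Proof.
  intros Han Hser Hb0 Hb1 [H [[L [HL [L0 [HLexp HH]]]] [omega [Hom [om0 [omlt Hsub]]]]]].
  destruct (schwarz_function_coef omega Hom om0 omlt) as [c1 [c2 [Jom Hc]]].
  exists c1, c2; split; [exact Hc|].
  destruct (analytic_Jet_0 _ HL) as [l1 [l2 JL]]; rewrite L0 in JL.
  assert (JD : Jet (C_derive F) (b 1%nat) (2 * b 2%nat)%C (3 * b 3%nat)%C).
  { apply C_derive_series_Jet; [|exact Hser].
    generalize near0_in_disk; apply near0_imp; auto. }
  assert (JD' : Jet (C_derive F) 1 l1 (l2 + l1 ^ 2 / 2)%C).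
  { generalize (Jet_Cexp_comp _ _ _ JL); apply Jet_ext.
    generalize near0_in_disk; apply near0_imp; auto. }
  destruct (Jet_unique _ _ _ _ _ _ _ JD JD') as [_ [E1 E2]].
  assert (JH : Jet H 1 (lambda * l1)%C (lambda * l2 + (lambda * l1) ^ 2 / 2)%C).
  { assert (JlL : Jet (fun h => lambda * L h)%C 0 (lambda * l1)%C (lambda * l2)%C)
      by (eapply Jet_eq; [apply (Jet_scal lambda _ _ _ _ JL)|..]; ring).
    generalize (Jet_Cexp_comp _ _ _ JlL); apply Jet_ext.
    generalize near0_in_disk; apply near0_imp; intros z Hz; symmetry; auto. }
  set (F1 := fun h => ((F h - b 0%nat) / h)%C).
  pose proof (series_near0_Jet _ _ (series_near0_shift _ _ Hser)) as JF1.
  change (Jet F1 (b 1%nat) (b 2%nat) (b 3%nat)) in JF1; rewrite Hb1 in JF1.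
  set (k := RtoC kappa) in *; set (t := RtoC (tau kappa)) in *.
  set (den := fun h => (1 + - (k * t) * omega h + - t ^ 2 * (omega h * omega h))%C).
  assert (Jom2 : Jet (fun h => omega h * omega h)%C 0 0 (c1 ^ 2)%C)
    by (eapply Jet_eq; [apply (Jet_mult _ _ _ _ _ _ _ _ Jom Jom)|..]; ring).
  assert (Jden : Jet den 1 (- (k * t) * c1)%C (- (k * t) * c2 + - t ^ 2 * c1 ^ 2)%C).
  { eapply Jet_eq; [apply Jet_plus; [apply Jet_plus; [apply Jet_const|apply Jet_scal, Jom]
      |apply Jet_scal, Jom2]|..]; ring. }
  assert (Jnum : Jet (fun h => 1 + t ^ 2 * (omega h * omega h))%C 1 0 (t ^ 2 * c1 ^ 2)%C).
  { eapply Jet_eq; [apply Jet_plus; [apply Jet_const|apply Jet_scal, Jom2]|..]; ring. }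
  assert (N1 : RtoC 1 <> RtoC 0) by (intros E; injection E; lra).
  pose proof (Jet_mult _ _ _ _ _ _ _ _ JH Jden) as JA.
  pose proof (Jet_mult _ _ _ _ _ _ _ _ JF1 Jnum) as JB.
  assert (Heq : near0 (fun h => H h * den h = F1 h * (1 + t ^ 2 * (omega h * omega h)))%C).
  { generalize (near0_and _ _ (near0_and _ _ near0_in_disk near0_neq0)
      (near0_and _ _ (Jet_neq0 _ _ _ _ Jden N1) (Jet_neq0 _ _ _ _ JF1 N1))).
    apply near0_imp; intros h [[Hd Hh] [Hden HF1]].
    rewrite Cmod_1 in Hden, HF1.
    assert (Hden0 : den h <> 0%C) by (apply Cmod_gt_0; lra).
    assert (HF0 : F1 h <> 0%C) by (apply Cmod_gt_0; lra).
    specialize (Hsub h Hd); unfold quotient_fun in Hsub.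
    destruct (Ceq_dec h 0%C) as [e|_]; [now contradiction e|].
    unfold p_tilde in Hsub; fold k t in Hsub.
    replace (1 - k * t * omega h - t ^ 2 * omega h ^ 2)%C with (den h) in Hsub
      by (unfold den; ring).
    assert (HFF : F h = (h * F1 h)%C) by (unfold F1; rewrite Hb0; field; auto).
    rewrite HFF in Hsub.
    replace (H h) with (h * H h / (h * F1 h) * F1 h)%C by (field; auto).
    rewrite Hsub; field; auto. }
  destruct (Jet_unique _ _ _ _ _ _ _ (Jet_ext _ _ _ _ _ Heq JA) JB) as [_ [Q1 Q2]].
  assert (El1 : l1 = (2 * b 2%nat)%C) by auto.
  assert (El2 : l2 = (3 * b 3%nat - 2 * b 2%nat ^ 2)%C).
  { replace l2 with ((l2 + l1 ^ 2 / 2) - l1 ^ 2 / 2)%C by ring.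
    rewrite <- E2, El1; field. }
  rewrite El1, El2 in Q2; rewrite El1 in Q1.
  replace (RtoC (2 * lambda - 1)) with (2 * lambda - 1)%C
    by (rewrite RtoC_minus, RtoC_mult; reflexivity).
  replace (RtoC (3 * lambda - 1)) with (3 * lambda - 1)%C
    by (rewrite RtoC_minus, RtoC_mult; reflexivity).
  replace (RtoC (2 * lambda ^ 2 - 4 * lambda + 1)) with (2 * lambda ^ 2 - 4 * lambda + 1)%C
    by (rewrite RtoC_plus, RtoC_minus, !RtoC_mult, RtoC_pow; reflexivity).
  replace (RtoC (kappa * tau kappa)) with (k * t)%C by (symmetry; apply RtoC_mult).
  replace (RtoC ((kappa ^ 2 + 2) * tau kappa ^ 2)) with ((k ^ 2 + 2) * t ^ 2)%C
    by (rewrite RtoC_mult, RtoC_plus, !RtoC_pow; reflexivity).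
  assert (R1 : (2 * lambda * b 2%nat = k * t * c1 + b 2%nat)%C).
  { transitivity (1 * (- (k * t) * c1) + lambda * (2 * b 2%nat) * 1 + k * t * c1)%C;
      [ring|rewrite Q1; ring]. }
  assert (G1 : ((2 * lambda - 1) * b 2%nat = k * t * c1)%C).
  { transitivity (2 * lambda * b 2%nat - b 2%nat)%C; [ring|rewrite R1; ring]. }
  split; [exact G1|].
  (* [Q2] still contains the product of [b2] and [c1]; a multiple of [G1] trades it for
     squares. *)
  match type of Q2 with ?A = ?B =>
    transitivity (k * t * c2 + (k ^ 2 + 2) * t ^ 2 * c1 ^ 2 + (A - B)
      + (k * t * c1 - (2 * lambda - 1) * b 2%nat) * (b 2%nat - k * t * c1))%C
  end; [field|rewrite Q2, G1; ring].
Qed.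

(** * Inverse function and coefficient bounds *)

(** With [f = z f1] and [g = w g1], the equation [f (g w) = w] becomes
    [g1 * (f1 o g) = 1]; compare the coefficients of [1], [w] and [w^2]. *)
Lemma inverse_coefficients (f g : C -> C) (a b : nat -> C) :
  series_near0 a f -> f 0%C = 0%C -> a 0%nat = 0%C -> a 1%nat = 1%C ->
  series_near0 b g -> b 0%nat = 0%C ->
  near0 (fun w => f (g w) = w) ->
  b 1%nat = 1%C /\ b 2%nat = (- a 2%nat)%C /\
  b 3%nat = (2 * a 2%nat ^ 2 - a 3%nat)%C.
Proof.
  intros Hf f0 a0 a1 Hg b0 Hfg.
  set (f1 := fun z => if Ceq_dec z 0%C then RtoC 1 else ((f z - a 0%nat) / z)%C).
  assert (f10 : f1 0%C = 1%C)
    by (unfold f1; destruct (Ceq_dec 0%C 0%C) as [_|n]; [reflexivity|now contradiction n]).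
  assert (Hf1 : forall z, f z = (z * f1 z)%C).
  { intros z; unfold f1; destruct (Ceq_dec z 0%C) as [->|n];
      [rewrite f0; ring|rewrite a0; field; auto]. }
  assert (Jf1 : Jet f1 1 (a 2%nat) (a 3%nat)).
  { rewrite <- a1; generalize (series_near0_Jet _ _ (series_near0_shift _ _ Hf)).
    apply Jet_ext; generalize near0_neq0; apply near0_imp; intros h Hh.
    unfold f1; destruct (Ceq_dec h 0%C); [contradiction|reflexivity]. }
  pose proof (series_near0_Jet _ _ Hg) as Jg; rewrite b0 in Jg.
  pose proof (series_near0_Jet _ _ (series_near0_shift _ _ Hg)) as Jg1; cbv beta in Jg1.
  pose proof (Jet_mult _ _ _ _ _ _ _ _ Jg1 (Jet_comp _ _ _ _ _ _ _ Jf1 f10 Jg)) as JP.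
  assert (HP : near0 (fun w => ((g w - b 0%nat) / w) * f1 (g w) = 1)%C).
  { generalize (near0_and _ _ Hfg near0_neq0); apply near0_imp; intros w [H1 H2].
    rewrite Hf1 in H1; rewrite b0.
    transitivity (g w * f1 (g w) / w)%C; [field; auto|rewrite H1; field; auto]. }
  destruct (Jet_unique _ _ _ _ _ _ _ (Jet_ext _ _ _ _ _ HP JP) (Jet_const 1)) as [E0 [E1 E2]].
  assert (H1 : b 1%nat = 1%C) by (rewrite <- E0; ring).
  rewrite H1 in E1, E2.
  assert (H2 : b 2%nat = (- a 2%nat)%C).
  { transitivity (1 * (a 2%nat * 1) + b 2%nat * 1 - a 2%nat)%C; [ring|rewrite E1; ring]. }
  split; [exact H1|]; split; [exact H2|].
  rewrite H2 in E2.
  match type of E2 with ?A = _ =>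
    transitivity (A + 2 * a 2%nat ^ 2 - a 3%nat)%C end; [ring|rewrite E2; ring].
Qed.

Lemma Cmod_half_diff_le (x y : C) (M : R) :
  Cmod x <= M -> Cmod y <= M -> Cmod ((x - y) / 2)%C <= M.
Proof.
  intros Hx Hy; assert (H2 : RtoC 2 <> RtoC 0) by (intros E; injection E; lra).
  rewrite Cmod_div, Cmod_R, Rabs_pos_eq by (auto; lra).
  pose proof (Cmod_triangle x (- y)) as T; rewrite Cmod_opp in T.
  unfold Cminus; lra.
Qed.

(** Here [w] is the square of the second coefficient of [f], [c] and [d] are the second
    coefficients of the two Schwarz functions, and the bound on [c] and [d] is
    [1 - |c1|^2] with [|c1|^2] expressed through [w]. Since [|w|] appears on both sides of
    [|w| <= A (1 - beta |w| / A)], it can be solved for. *)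
Lemma quadratic_coef_bound (A beta : R) (w c d : C) :
  0 < A -> w = (A * ((c + d) / 2))%C ->
  Cmod c <= 1 - beta * (Cmod w / A) -> Cmod d <= 1 - beta * (Cmod w / A) ->
  Cmod w * (1 + beta) <= A.
Proof.
  intros HA Hw Hc Hd.
  assert (H : Cmod ((c + d) / 2)%C <= 1 - beta * (Cmod w / A)).
  { replace (c + d)%C with (c - - d)%C by ring.
    apply Cmod_half_diff_le; [exact Hc|rewrite Cmod_opp; exact Hd]. }
  assert (HwA : Cmod w = A * Cmod ((c + d) / 2)%C)
    by (rewrite Hw, Cmod_mult, Cmod_R, Rabs_pos_eq; lra).
  assert (Hx : Cmod w <= A * (1 - beta * (Cmod w / A)))
    by (rewrite HwA at 1; apply Rmult_le_compat_l; lra).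
  replace (A * (1 - beta * (Cmod w / A))) with (A - beta * Cmod w) in Hx by (field; lra).
  lra.
Qed.

(** The functional is a combination of [c] and [d] through [w = A (c + d) / 2], and the
    estimate depends on how it is split. For [q <= s A] it is [(s - q / A) w + q d], whose
    bound [q + |w| / A * (s A - q (1 + beta))] is affine in [|w|]: for a
    nonpositive slope it is largest at [w = 0], otherwise at the bound for [|w|] from
    [quadratic_coef_bound], whence the threshold [s A = q (1 + beta)]. For [s A <= q] it is
    [s A d - (q - s A) (c - d) / 2], bounded by [q]. *)
Lemma fekete_szego_bound_pos (q A beta s : R) (w c d : C) :
  0 <= q -> 0 < A -> 0 <= beta -> 0 <= s -> w = (A * ((c + d) / 2))%C ->
  Cmod c <= 1 - beta * (Cmod w / A) -> Cmod d <= 1 - beta * (Cmod w / A) ->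
  let W := (s * w - q * ((c - d) / 2))%C in
  (s * A <= q * (1 + beta) -> Cmod W <= q) /\
  (q * (1 + beta) <= s * A -> Cmod W <= s * A / (1 + beta)).
Proof.
  intros Hq HA Hbeta Hs Hw Hc Hd W.
  pose proof (quadratic_coef_bound _ _ _ _ _ HA Hw Hc Hd) as Hx.
  pose proof (Cmod_half_diff_le _ _ _ Hc Hd) as HU.
  assert (HA0 : RtoC A <> RtoC 0) by (intros E; injection E; lra).
  set (x := Cmod w / A) in *.
  assert (Hx0 : 0 <= x)
    by (apply Rmult_le_pos; [apply Cmod_ge_0|apply Rlt_le, Rinv_0_lt_compat, HA]).
  assert (Hxw : Cmod w = A * x) by (unfold x; field; lra).
  assert (Hx1 : x * (1 + beta) <= 1).
  { rewrite Hxw in Hx; apply Rmult_le_reg_l with A; [exact HA|lra]. }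
  destruct (Rle_or_lt q (s * A)) as [Hqs|Hqs].
  - assert (HW : Cmod W <= q + x * (s * A - q * (1 + beta))).
    { replace W with (RtoC (s - q / A) * w + q * d)%C.
      2:{ unfold W; rewrite RtoC_minus, RtoC_div by lra; rewrite Hw; field; exact HA0. }
      assert (Hp : 0 <= s - q / A).
      { assert (E : s - q / A = (s * A - q) * / A) by (field; lra); rewrite E.
        apply Rmult_le_pos; [lra|apply Rlt_le, Rinv_0_lt_compat, HA]. }
      eapply Rle_trans; [apply Cmod_triangle|].
      rewrite !Cmod_mult, !Cmod_R, !Rabs_pos_eq by assumption.
      replace (q + x * (s * A - q * (1 + beta)))
        with ((s - q / A) * (A * x) + q * (1 - beta * x)) by (field; lra).
      rewrite <- Hxw; apply Rplus_le_compat_l, Rmult_le_compat_l; assumption. }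
    split; intros H; [nra|].
    apply Rmult_le_reg_r with (1 + beta); [lra|].
    replace (s * A / (1 + beta) * (1 + beta)) with (s * A) by (field; lra).
    nra.
  - assert (HW : Cmod W <= q).
    { replace W with (RtoC (s * A) * d + - (RtoC (q - s * A) * ((c - d) / 2)))%C.
      2:{ unfold W; rewrite RtoC_minus, !RtoC_mult, Hw; field. }
      assert (HsA : 0 <= s * A) by (apply Rmult_le_pos; lra).
      eapply Rle_trans; [apply Cmod_triangle|].
      rewrite Cmod_opp, (Cmod_mult (RtoC (s * A)%R)), (Cmod_mult (RtoC (q - s * A)%R)),
        !Cmod_R, !Rabs_pos_eq by lra.
      assert (0 <= beta * x) by now apply Rmult_le_pos.
      nra. }
    split; intros H; [exact HW|nra].
Qed.

(** For [s < 0], exchanging [c] and [d] changes the sign of the functional. *)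
Lemma fekete_szego_bound (q A beta s : R) (w c d : C) :
  0 <= q -> 0 < A -> 0 <= beta -> w = (A * ((c + d) / 2))%C ->
  Cmod c <= 1 - beta * (Cmod w / A) -> Cmod d <= 1 - beta * (Cmod w / A) ->
  let W := (s * w - q * ((c - d) / 2))%C in
  (Rabs s * A <= q * (1 + beta) -> Cmod W <= q) /\
  (q * (1 + beta) <= Rabs s * A -> Cmod W <= Rabs s * A / (1 + beta)).
Proof.
  intros Hq HA Hbeta Hw Hc Hd W.
  destruct (Rle_or_lt 0 s) as [Hs|Hs].
  - rewrite Rabs_pos_eq by exact Hs.
    now apply (fekete_szego_bound_pos q A beta s w c d).
  - rewrite Rabs_left by exact Hs.
    replace (Cmod W) with (Cmod (RtoC (- s) * w - q * ((d - c) / 2))%C).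
    + apply (fekete_szego_bound_pos q A beta (- s) w d c); auto; [lra|].
      rewrite Hw; f_equal; f_equal; ring.
    + rewrite <- Cmod_opp; f_equal; unfold W; rewrite RtoC_opp; field.
Qed.

Lemma tau_neg (kappa : R) : tau kappa < 0.
Proof.
  unfold tau; assert (H : kappa < sqrt (kappa ^ 2 + 4)); [|lra].
  destruct (Rle_or_lt 0 kappa) as [Hk|Hk].
  - rewrite <- (sqrt_pow2 kappa) at 1 by exact Hk.
    apply sqrt_lt_1; nra.
  - pose proof (sqrt_pos (kappa ^ 2 + 4)); lra.
Qed.

Ltac push_RtoC :=
  repeat first [rewrite RtoC_plus | rewrite RtoC_minus | rewrite RtoC_mult
               | rewrite RtoC_opp | rewrite RtoC_pow].

Theorem theorem2p3 (kappa lambda : R) (hkappa : 0 < kappa) (hlambda : 1 <= lambda)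
    (f : C -> C) (a : nat -> C)
    (ha : normalized_expansion f a) (hf : class_SLB kappa lambda f) :
  let t := tau kappa in
  let D := lambda * (2 * lambda - 1) * kappa ^ 2 * t
           + (kappa - (kappa ^ 2 + 2) * t) * (2 * lambda - 1) ^ 2 in
  Cmod (a 2%nat) <= Rabs (kappa * t) * sqrt kappa / sqrt D
  /\
  Cmod (a 3%nat) <=
    Rabs (kappa * t)
    * ((kappa - (kappa ^ 2 + 2) * t) * (2 * lambda - 1) ^ 2
       + (2 * lambda ^ 2 - 4 * lambda + 1) * kappa ^ 2 * t)
    / ((3 * lambda - 1) * D)
  /\
  forall mu : R,
    (0 <= Rabs (mu - 1) <= D / (kappa ^ 2 * Rabs t * (3 * lambda - 1)) ->
     Cmod (a 3%nat - RtoC mu * a 2%nat ^ 2)%C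
       <= Rabs (kappa * t) / (3 * lambda - 1))
    /\
    (Rabs (mu - 1) >= D / (kappa ^ 2 * Rabs t * (3 * lambda - 1)) ->
     Cmod (a 3%nat - RtoC mu * a 2%nat ^ 2)%C
       <= Rabs (1 - mu) * kappa ^ 3 * t ^ 2 / D).
Proof.
  intros t D.
  destruct ha as [a0 [a1 Ha]].
  destruct hf as [[[Hfan _] [Hfuni _]] [g [[Hgan [Hguni Hinv]] [Hsf Hsg]]]].
  assert (D0 : in_disk 0%C) by (unfold in_disk; rewrite Cmod_0; lra).
  assert (f0 : f 0%C = 0%C).
  { transitivity (a 0%nat); [|exact a0].
    exact (filterlim_locally_unique _ _ _ (Ha _ D0)
      (is_pseries_0 (K := C_AbsRing) (V := C_NormedModule) a)). }
  assert (Sf : series_near0 a f)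
    by (generalize near0_in_disk; apply near0_imp; exact Ha).
  destruct Hinv as [r [Hr Hfg]].
  assert (g0 : g 0%C = 0%C).
  { destruct (Hfg 0%C) as [H1 H2]; [rewrite Cmod_0; exact Hr|].
    apply Hfuni; auto; congruence. }
  destruct (analytic_at_series _ _ (Hgan _ D0)) as [b [b0 Sg']]; rewrite g0 in b0.
  assert (Sg : series_near0 b g).
  { revert Sg'; apply near0_imp; intros h Hh; now replace (0 + h)%C with h in Hh by ring. }
  destruct (inverse_coefficients f g a b Sf f0 a0 a1 Sg b0) as [b1 [b2 b3]].
  { exists r; split; [exact Hr|]; intros w Hw; apply Hfg; lra. }
  destruct (subordination_coefficients _ _ _ _ Hfan Sf a0 a1 Hsf)
    as [c1 [c2 [Hc [F1 F2]]]].
  destruct (subordination_coefficients _ _ _ _ Hgan Sg b0 b1 Hsg)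
    as [d1 [d2 [Hd [G1 G2]]]].
  rewrite b2 in G1, G2; rewrite b3 in G2; fold t in F1, F2, G1, G2.
  clear Hsf Hsg Hfan Hgan Hfuni Hguni Hfg Sf Sg Sg' Ha.
  pose proof (tau_neg kappa) as Ht; fold t in Ht; clearbody t.
  set (N := 2 * lambda - 1) in *; set (m := 3 * lambda - 1) in *.
  assert (HN : 1 <= N) by (unfold N; lra).
  assert (Hm : 2 <= m) by (unfold m; lra).
  (* [E] is [D - kappa N^2], in a form that shows its sign since [t < 0]. *)
  set (E := - t * N * ((lambda - 1) * kappa ^ 2 + 2 * N)).
  assert (HE : 0 < E).
  { unfold E; apply Rmult_lt_0_compat; [nra|].
    pose proof (pow2_ge_0 kappa); nra. }
  assert (HD : D = E + kappa * N ^ 2) by (unfold D, E, N; ring).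
  clearbody D.
  assert (HDp : 0 < D) by (rewrite HD; assert (0 < N ^ 2) by (apply pow_lt; lra); nra).
  set (p := - (kappa * t)).
  assert (Hp : 0 < p) by (unfold p; nra).
  assert (Habs : Rabs (kappa * t) = p) by (unfold p; apply Rabs_left; nra).
  set (w := (a 2%nat ^ 2)%C).
  set (A := kappa ^ 3 * t ^ 2 / E); set (beta := kappa * N ^ 2 / E); set (q := p / m).
  assert (Hk3 : 0 < kappa ^ 3 * t ^ 2) by (apply Rmult_lt_0_compat; [apply pow_lt|]; nra).
  assert (HA : 0 < A) by now apply Rdiv_lt_0_compat.
  assert (HN2 : 0 < N ^ 2) by (apply pow_lt; lra).
  assert (Hbeta : 0 < beta) by (apply Rdiv_lt_0_compat; [nra|lra]).
  assert (Hq : 0 < q) by (apply Rdiv_lt_0_compat; lra).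
  (* The first relations determine [c1] and [- d1] from [a2]; both satisfy the same
     equation. *)
  assert (Hsq : forall c : C, (RtoC N * a 2%nat = RtoC (kappa * t) * c)%C ->
            Cmod c ^ 2 = beta * (Cmod w / A)
            /\ (RtoC (kappa ^ 2 * t ^ 2) * c ^ 2 = RtoC (N ^ 2) * w)%C).
  { intros c H; split.
    - apply (f_equal Cmod) in H; rewrite !Cmod_mult, !Cmod_R, Habs, Rabs_pos_eq in H by lra.
      unfold w; rewrite Cmod_pow.
      replace (Cmod c) with (N * Cmod (a 2%nat) / p) by (rewrite H; field; lra).
      unfold beta, A, p; field; repeat split; lra.
    - unfold w; rewrite !RtoC_mult, !RtoC_pow in *.
      transitivity ((kappa * t * c) ^ 2)%C; [ring|rewrite <- H; ring]. }
  destruct (Hsq c1 F1) as [Hc1 Hc1w].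
  assert (G1' : (RtoC N * a 2%nat = RtoC (kappa * t) * - d1)%C).
  { transitivity (- (RtoC N * - a 2%nat))%C; [ring|rewrite G1; ring]. }
  destruct (Hsq (- d1)%C G1') as [Hd1 Hd1w]; rewrite Cmod_opp in Hd1.
  rewrite Hc1 in Hc; rewrite Hd1 in Hd.
  replace ((- d1) ^ 2)%C with (d1 ^ 2)%C in Hd1w by ring.
  assert (HC : forall x : R, x <> 0 -> RtoC x <> RtoC 0)
    by (intros x Hx Ex; injection Ex; lra).
  (* The sum of the second-order relations of [f] and [g]; the next claim is their
     difference. *)
  assert (Hw : w = (A * ((c2 + d2) / 2))%C).
  { apply (Cmult_eq_reg_l (RtoC (2 * E))); [|apply HC; lra].
    transitivity (RtoC (kappa ^ 3 * t ^ 2) * (c2 + d2))%C.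
    2:{ replace (kappa ^ 3 * t ^ 2) with (A * E) by (unfold A; field; lra).
        rewrite !RtoC_mult; field. }
    match type of F2 with ?F = _ => match type of G2 with ?G = _ =>
      transitivity (RtoC (kappa ^ 2 * t) * (F + G)
        - RtoC ((kappa ^ 2 + 2) * t) * (RtoC (N ^ 2) * w + RtoC (N ^ 2) * w))%C
    end end.
    - unfold E, N, m, w; push_RtoC; ring.
    - rewrite F2, G2; rewrite <- Hc1w at 1; rewrite <- Hd1w; push_RtoC; ring. }
  assert (Ha3 : (a 3%nat - w = - (q * ((c2 - d2) / 2)))%C).
  { apply (Cmult_eq_reg_l (RtoC (2 * m))); [|apply HC; lra].
    transitivity (RtoC (kappa * t) * (c2 - d2))%C.
    2:{ replace (kappa * t) with (- (q * m)) by (unfold q, p; field; lra).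
        push_RtoC; field. }
    assert (Hcd : (RtoC (kappa ^ 2 * t ^ 2) * c1 ^ 2 = RtoC (kappa ^ 2 * t ^ 2) * d1 ^ 2)%C)
      by congruence.
    apply Cmult_eq_reg_l in Hcd; [|apply HC; nra].
    match type of F2 with ?F = _ => match type of G2 with ?G = _ =>
      transitivity (F - G)%C end end.
    - unfold m, w; push_RtoC; ring.
    - rewrite F2, G2, Hcd; ring. }
  pose proof (quadratic_coef_bound _ _ _ _ _ HA Hw Hc Hd) as Hx.
  assert (Hxw : Cmod w <= kappa ^ 3 * t ^ 2 / D).
  { replace (kappa ^ 3 * t ^ 2 / D) with (A / (1 + beta))
      by (unfold A, beta; rewrite HD; field; split; nra).
    apply Rmult_le_reg_r with (1 + beta); [lra|].
    replace (A / (1 + beta) * (1 + beta)) with A by (field; lra); exact Hx. }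
  split; [|split].
  - apply Rsqr_incr_0_var.
    + replace (Rsqr (Cmod (a 2%nat))) with (Cmod w)
        by (unfold w, Rsqr; rewrite Cmod_pow; ring).
      eapply Rle_trans; [exact Hxw|right].
      rewrite Habs; unfold Rsqr, p.
      transitivity (kappa ^ 2 * t ^ 2 * (sqrt kappa * sqrt kappa) / (sqrt D * sqrt D)).
      * rewrite !sqrt_sqrt by lra; field; lra.
      * field; apply Rgt_not_eq, sqrt_lt_R0, HDp.
    + rewrite Habs; apply Rmult_le_pos;
        [apply Rmult_le_pos; [lra|apply sqrt_pos]
        |apply Rlt_le, Rinv_0_lt_compat, sqrt_lt_R0, HDp].
  - replace (a 3%nat) with (w + - (q * ((c2 - d2) / 2)))%C by (rewrite <- Ha3; ring).
    eapply Rle_trans; [apply Cmod_triangle|].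
    rewrite Cmod_opp, Cmod_mult, Cmod_R, Rabs_pos_eq by lra.
    pose proof (Cmod_half_diff_le _ _ _ Hc Hd) as HU.
    assert (Hbx : 0 <= beta * (Cmod w / A)).
    { rewrite <- Hc1; apply pow2_ge_0. }
    apply Rle_trans with (kappa ^ 3 * t ^ 2 / D + q); [nra|right].
    rewrite Habs.
    replace ((kappa - (kappa ^ 2 + 2) * t) * N ^ 2
      + (2 * lambda ^ 2 - 4 * lambda + 1) * kappa ^ 2 * t) with (D - m * kappa ^ 2 * t)
      by (rewrite HD; unfold E, m, N; ring).
    unfold q, p; field; lra.
  - intros mu.
    replace (a 3%nat - mu * w)%C with (RtoC (1 - mu) * w - q * ((c2 - d2) / 2))%C.
    2:{ rewrite RtoC_minus; transitivity ((1 - mu) * w + - (q * ((c2 - d2) / 2)))%C;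
        [ring|rewrite <- Ha3; ring]. }
    destruct (fekete_szego_bound q A beta (1 - mu) w c2 d2) as [B1 B2]; try assumption; try lra.
    assert (Hth : D / (kappa ^ 2 * Rabs t * m) = q * (1 + beta) / A).
    { rewrite (Rabs_left t Ht); unfold q, A, beta, p; rewrite HD; field.
      repeat split; nra. }
    rewrite Hth, (Rabs_minus_sym mu 1), Habs; split; intros H.
    + apply B1; destruct H as [_ H].
      apply (Rmult_le_compat_r A) in H; [|lra].
      replace (q * (1 + beta) / A * A) with (q * (1 + beta)) in H by (field; lra); exact H.
    + replace (Rabs (1 - mu) * kappa ^ 3 * t ^ 2 / D) with (Rabs (1 - mu) * A / (1 + beta))
        by (unfold A, beta; rewrite HD; field; split; nra).
      apply B2; apply Rge_le, (Rmult_le_compat_r A) in H; [|lra].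
      replace (q * (1 + beta) / A * A) with (q * (1 + beta)) in H by (field; lra); exact H.
Qed.
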